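(* Let $\mathcal{E}_1,\mathcal{E}_2$ be non-isogenous elliptic curves $y_i^2=x_i(x_i-1)(x_i-\lambda_i)$. The Jacobian elliptic fibrations $\mathcal{J}_8,\mathcal{J}_{10},\mathcal{J}_{11}$ on $\operatorname{Kum}(\mathcal{E}_1\times\mathcal{E}_2)$ are obtained from the Jacobian elliptic fibrations $\mathcal{J}_7,\mathcal{J}_9,\mathcal{J}_7$, respectively, by the following rational transformations (where $(u_j,x_j,y_j)$ are the base coordinate and Weierstrass coordinates of $\mathcal{J}_j$), which leave the holomorphic two-form invariant, i.e. $du_8\wedge\frac{dx_8}{y_8}=du_7\wedge\frac{dx_7}{y_7}$, $du_{10}\wedge\frac{dx_{10}}{y_{10}}=du_9\wedge\frac{dx_9}{y_9}$, $du_{11}\wedge\frac{dx_{11}}{y_{11}}=du_7\wedge\frac{dx_7}{y_7}$: - $\mathcal{J}_8$ from $\mathcal{J}_7$: $$u_8=\frac{u_7^2(u_7-1)}{x_7},\quad x_8=\frac{\big(x_7-(\lambda_1-1)(\lambda_2-1)u_7^2(u_7-1)\big)u_7^2}{x_7^2},\quad y_8=-\frac{\big(x_7-(\lambda_1-1)(\lambda_2-1)u_7^2(u_7-1)\big)u_7^4\,y_7}{x_7^4}.$$ - $\mathcal{J}_{10}$ from $\mathcal{J}_9$: $$u_{10}=\frac{x_9}{(u_9-1)^2},\quad x_{10}=-\frac{\lambda_1\lambda_2(\lambda_1-1)(\lambda_2-1)u_9}{u_9-1},\quad y_{10}=-\frac{\lambda_1\lambda_2(\lambda_1-1)(\lambda_2-1)y_9}{(u_9-1)^4}.$$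 - $\mathcal{J}_{11}$ from $\mathcal{J}_7$: $$u_{11}=\frac{\lambda_2u_7^2(u_7-1)^2}{x_7},\quad x_{11}=-\frac{\lambda_2^2(\lambda_1-1)(\lambda_2-1)u_7^4(u_7-1)^3}{x_7^2},\quad y_{11}=\frac{\lambda_2^3(\lambda_1-1)(\lambda_2-1)u_7^6(u_7-1)^4y_7}{x_7^4}.$$
   Context: $\operatorname{Kum}(\mathcal{E}_1\times\mathcal{E}_2)$ is the minimal resolution of $(\mathcal{E}_1\times\mathcal{E}_2)/\{\pm1\}$. By Oguiso's classification (with Weierstrass equations computed by Kuwata–Shioda) it has eleven distinct Jacobian elliptic fibrations $\mathcal{J}_1,\dots,\mathcal{J}_{11}$, distinguished by their singular fibers. Those relevant here have singular fibers: $\mathcal{J}_7$: $I_4^*+2I_0^*+2I_1$; $\mathcal{J}_8$: $III^*+I_2^*+3I_2+I_1$; $\mathcal{J}_9$: $II^*+2I_0^*+2I_1$; $\mathcal{J}_{10}$: $I_8^*+I_0^*+4I_1$; $\mathcal{J}_{11}$: $2I_4^*+4I_1$. ''Weierstrass coordinates'' $(x_j,y_j)$ of $\mathcal{J}_j$ means that the fibration over the $u_j$-line is given by $y_j^2=$ a monic cubic in $x_j$ whose coefficients are polynomials in $u_j$ (over $\mathbb{C}(\lambda_1,\lambda_2)$). For $j=7,9$ they are related to the Weierstrass normal form $Y^2=4X^3-G_2(u)X-G_3(u)$ of $\mathcal{J}_j$ by $u_j=u$, $y_j=Y/2$, $x_j=X+p_j(u)$ for a suitable polynomial $p_j$ in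 $u$ with coefficients in $\mathbb{C}(\lambda_1,\lambda_2)$ (the one relating it to Kuwata–Shioda's equation). These normal forms are as follows. For $\mathcal{J}_7$: $G_2=g_2(t)T^2$, $G_3=g_3(t)T^3$ with $g_2=\frac13(64t^2-64t+4)$, $g_3=\frac8{27}(2t-1)(32t^2-32t-1)$, $t=\frac{(\lambda_1\lambda_2+1)u-\lambda_1-\lambda_2}{4d_7(u-1)}+\frac12$, $T=d_7u(u-1)^2$, $d_7^2=\lambda_1\lambda_2$. For $\mathcal{J}_9$: $G_2=3T^2$, $G_3=(2t-1)T^3$ with $t=\frac{B_9u-A_9}{u-1}$, $T=-\frac23d_9u(u-1)^2$, $d_9^2=(\lambda_1^2-\lambda_1+1)(\lambda_2^2-\lambda_2+1)$, and $$A_9=\frac{(2\lambda_1\lambda_2-\lambda_1-\lambda_2+2)(\lambda_1\lambda_2+\lambda_1-2\lambda_2+1)(\lambda_1\lambda_2-2\lambda_1+\lambda_2+1)}{4d_9^3}+\frac12,$$ $$B_9=\frac{(2\lambda_1\lambda_2-\lambda_1-\lambda_2-1)(\lambda_1\lambda_2+\lambda_1+\lambda_2-2)(\lambda_1\lambda_2-2\lambda_1-2\lambda_2+1)}{4d_9^3}+\frac12.$$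
   Formalization: The listed singular fibers of J_8, J_10, J_11 are shown exactly for (λ1,λ2) off a proper closed subset; for every non-isogenous pair they hold up to I_1+I_1 merging into II or I_2+I_1 into III (as for J_8 when λ1+λ2=0). *)

(* Defs.v *)
From HB Require Import structures.
From mathcomp Require Import all_boot all_order all_algebra.
From mathcomp Require Import complex reals.
From mathcomp Require Import ring.

Set Implicit Arguments.
Unset Strict Implicit.
Unset Printing Implicit Defensive.

Import Order.TTheory GRing.Theory Num.Theory.

Local Open Scope ring_scope.

(* Elements of C[u] are of type {poly C}; elements of C[u][x] are of type
   {poly {poly C}}, where the outer variable is x and the inner one is u. *)

(* Function fields over C.  A field K with a map iota : C -> K (always a ring
   morphism in the uses below) is seen as an extension of C. *)
Section FunctionField.
Variables (C K : fieldType) (iota : C -> K).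

Definition ev1 (f : {poly C}) (u : K) : K := (map_poly iota f).[u].

Definition ev2 (f : {poly {poly C}}) (u x : K) : K :=
  (map_poly (fun c => ev1 c u) f).[x].

Definition alg_indep (u x : K) : Prop :=
  forall f : {poly {poly C}}, f != 0 -> ev2 f u x != 0.

(* K = C(g_1, ..., g_n) *)
Definition generated_by (g : seq K) : Prop :=
  forall S : {pred K}, GRing.divring_closed S ->
    (forall c, iota c \in S) -> {subset g <= S} -> forall z, z \in S.

Definition derivation (D : K -> K) : Prop :=
  [/\ forall a b, D (a + b) = D a + D b,
      forall a b, D (a * b) = D a * b + a * D b
    & forall c, D (iota c) = 0].

(* (u, x, y) are Weierstrass coordinates, for the cubic f, of an elliptic
   fibration over the u-line of a surface with function field K. *)
Definition weierstrass_coordinates (f : {poly {poly C}}) (u x y : K) : Prop :=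
  [/\ f \is monic, size f = 4%N, alg_indep u x,
      generated_by [:: u; x; y] & y ^+ 2 = ev2 f u x].

End FunctionField.

(* The rational two-form du /\ dx / y, as an alternating map on pairs of
   derivations (rational vector fields). *)
Definition two_form (K : fieldType) (u x y : K) (D1 D2 : K -> K) : K :=
  (D1 u * D2 x - D2 u * D1 x) / y.

(* Kodaira types; KI 0 is a smooth fibre, a final s stands for a star. *)
Inductive kodaira :=
  | KI of nat | KII | KIII | KIV | KIs of nat | KIVs | KIIIs | KIIs.

(* Singular fibres of y^2 = f(u,x), with f a monic cubic in x over C[u].  The
   places of P^1 are Some a for u = a, and None for u = oo. *)
Section Kodaira.
Variables (C : fieldType) (f : {poly {poly C}}).
Let a2 := f`_2.
Let a4 := f`_1.
Let a6 := f`_0.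

Definition inv_c4 : {poly C} := 16%:R * a2 ^+ 2 - 48%:R * a4.
Definition inv_c6 : {poly C} :=
  288%:R * a2 * a4 - 64%:R * a2 ^+ 3 - 864%:R * a6.
Definition inv_disc : {poly C} :=
  16%:R * (a2 ^+ 2 * a4 ^+ 2 - 4%:R * a2 ^+ 3 * a6 - 4%:R * a4 ^+ 3
           + 18%:R * a2 * a4 * a6 - 27%:R * a6 ^+ 2).

Definition ord (v : option C) (p : {poly C}) : int :=
  if v is Some a then (mup a p)%:Z else - (size p).-1%:Z.

(* The zero polynomial has infinite order. *)
Definition ord_ge v p (n : int) : bool := (p == 0) || (n <= ord v p).
Definition ord_eq v p (n : int) : bool := (p != 0) && (ord v p == n).

(* Kodaira's table in residue characteristic 0.  The integer k is the rescaling
   (x, y) -> (x / pi^(2k), y / pi^(3k)), pi a uniformizer at v, that makes the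
   equation minimal at v; the table is applied to the minimal equation. *)
Definition has_fibre (v : option C) (t : kodaira) : Prop :=
  exists k : int,
    let ge4 n := ord_ge v inv_c4 (4 * k + n%:Z) in
    let eq4 n := ord_eq v inv_c4 (4 * k + n%:Z) in
    let ge6 n := ord_ge v inv_c6 (6 * k + n%:Z) in
    let eq6 n := ord_eq v inv_c6 (6 * k + n%:Z) in
    let eqD n := ord_eq v inv_disc (12 * k + n%:Z) in
    [/\ ge4 0%N, ge6 0%N, ~~ (ge4 4%N && ge6 6%N) &
    match t with
    | KI 0 => eqD 0%N
    | KI n => eq4 0%N && eqD n
    | KII => [&& ge4 1%N, eq6 1%N & eqD 2%N]
    | KIII => [&& eq4 1%N, ge6 2%N & eqD 3%N]
    | KIV => [&& ge4 2%N, eq6 2%N & eqD 4%N]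
    | KIs 0 => [&& ge4 2%N, ge6 3%N & eqD 6%N]
    | KIs n => [&& eq4 2%N, eq6 3%N & eqD (6 + n)%N]
    | KIVs => [&& ge4 3%N, eq6 4%N & eqD 8%N]
    | KIIIs => [&& eq4 3%N, ge6 5%N & eqD 9%N]
    | KIIs => [&& ge4 4%N, eq6 5%N & eqD 10%N]
    end].

(* The singular fibres over P^1 are exactly those of the list l. *)
Definition singular_fibres (l : seq kodaira) : Prop :=
  inv_disc != 0 /\
  exists s : seq (option C),
    [/\ uniq s, size s = size l,
        forall i, (i < size l)%N -> has_fibre (nth None s i) (nth (KI 0) l i)
      & forall v, v \notin s -> has_fibre v (KI 0)].

End Kodaira.

(* For special (l1, l2), a fibre I_1 may collide with another I_1 into a II, or
   with an I_2 into a III.  This changes neither the Euler numbers nor the root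
   lattices of the reducible fibres; it does happen for non-isogenous curves:
   e.g. 2 I_4^* + 2 II for l1 = -1, l2 = i in the case of J_11, and III in the
   case of J_8 as soon as l1 + l2 = 0. *)
Inductive collision : seq kodaira -> seq kodaira -> Prop :=
  | collision_none l : collision l l
  | collision_II l1 l2 l : collision (l1 ++ KII :: l2) l ->
      collision (l1 ++ KI 1 :: KI 1 :: l2) l
  | collision_III l1 l2 l : collision (l1 ++ KIII :: l2) l ->
      collision (l1 ++ KI 2 :: KI 1 :: l2) l.

Definition J8_fibres := [:: KIIIs; KIs 2; KI 2; KI 2; KI 2; KI 1].
Definition J10_fibres := [:: KIs 8; KIs 0; KI 1; KI 1; KI 1; KI 1].
Definition J11_fibres := [:: KIs 4; KIs 4; KI 1; KI 1; KI 1; KI 1].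

(* c is a rational expression, with rational coefficients, in l1 and l2 *)
Definition rational_in (C : fieldType) (l1 l2 c : C) : Prop :=
  forall S : {pred C}, GRing.divring_closed S -> l1 \in S -> l2 \in S -> c \in S.

(* (u, x, y) are Weierstrass coordinates of a Jacobian fibration on the surface
   with function field K, whose singular fibres are those of l, exactly so if
   (l1, l2) is generic and up to collisions in any case. *)
Definition jacobian_fibration (C K : fieldType) (iota : C -> K) (l1 l2 : C)
    (generic : Prop) (l : seq kodaira) (u x y : K) : Prop :=
  exists f : {poly {poly C}},
    [/\ weierstrass_coordinates iota f u x y,
        forall i j, rational_in l1 l2 f`_i`_j,
        generic -> singular_fibres f l
      & exists2 l', collision l l' & singular_fibres f l'].

(* The cubic x (x - 1) (x - l) of the Legendre curve E_l *)
Definition legendre (C : fieldType) (l : C) : {poly C} :=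
  'X * ('X - 1) * ('X - l%:P).

(* An isogeny E_l1 -> E_l2: a non-constant morphism with O |-> O.  It is given
   by X = (p0 + p1 y) / q and Y = (r0 + r1 y) / q in the function field
   C(x)[y] / (y^2 - x (x - 1) (x - l1)) of E_l1, subject to
   Y^2 = X (X - 1) (X - l2) (multiplied by q^3 below).  It maps O to O iff X
   has a pole at O, and is then non-constant; the pole orders at O of p0, p1 y
   and q are 2 deg p0, 2 deg p1 + 3 and 2 deg q.  Below, 'X is y. *)
Definition isogenous (C : fieldType) (l1 l2 : C) : Prop :=
  exists p0 p1 r0 r1 q : {poly C},
    let P : {poly {poly C}} := p0%:P + p1%:P * 'X in
    let S : {poly {poly C}} := r0%:P + r1%:P * 'X in
    [/\ q != 0,
        exists h : {poly {poly C}},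
          S ^+ 2 * q%:P - P * (P - q%:P) * (P - (l2%:P * q)%:P)
          = h * ('X ^+ 2 - (legendre l1)%:P)
      & (size q < size p0)%N || (p1 != 0) && (size q <= (size p1).+1)%N].

(* K is the function field of (E_l1 x E_l2) / {+-1}, hence of its resolution
   Kum(E_l1 x E_l2): the field of invariants of -1 = s acting on the function
   field M = C(x1, y1, x2, y2) of E_l1 x E_l2. *)
Definition kummer_function_field (C K : fieldType) (iota : C -> K) (l1 l2 : C)
    : Prop :=
  exists (M : fieldType) (j : {rmorphism K -> M}) (s : {rmorphism M -> M})
         (x1 y1 x2 y2 : M),
    let jC := fun c => j (iota c) in
    [/\ alg_indep jC x1 x2,
        generated_by jC [:: x1; y1; x2; y2],
        y1 ^+ 2 = ev1 jC (legendre l1) x1 /\ y2 ^+ 2 = ev1 jC (legendre l2) x2,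
        [/\ forall c, s (jC c) = jC c,
            s x1 = x1, s y1 = - y1, s x2 = x2 & s y2 = - y2]
      & forall z, s z = z <-> exists k, z = j k].

Section NormalForms.
Variable C : fieldType.

(* The cubic of y^2 = f(u,x), where Y^2 = 4 X^3 - G2 X - G3, y = Y / 2 and
   x = X + p *)
Definition normal_form (G2 G3 p : {poly C}) : {poly {poly C}} :=
  ('X - p%:P) ^+ 3 - (4%:R^-1 *: G2)%:P * ('X - p%:P) - (4%:R^-1 *: G3)%:P.

Variables l1 l2 : C.

Definition N7 : {poly C} := (l1 * l2 + 1) *: 'X - (l1 + l2)%:P.

Definition J7_G2 : {poly C} :=
  (4%:R / 3%:R) *: ('X ^+ 2 * ('X - 1) ^+ 2
                    * (N7 ^+ 2 - (3%:R * (l1 * l2)) *: ('X - 1) ^+ 2)).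
Definition J7_G3 : {poly C} :=
  (4%:R / 27%:R) *: ('X ^+ 3 * ('X - 1) ^+ 3 * N7
                     * (2%:R *: N7 ^+ 2 - (9%:R * (l1 * l2)) *: ('X - 1) ^+ 2)).

(* The shift that moves the 2-torsion section to x = y = 0:
   y^2 = x (x^2 - u (u - 1) N7 x + l1 l2 u^2 (u - 1)^4) *)
Definition J7_shift : {poly C} := 3%:R^-1 *: ('X * ('X - 1) * N7).

Definition J7 : {poly {poly C}} := normal_form J7_G2 J7_G3 J7_shift.

(* d9^2, and the numerators in A9 and B9 *)
Definition sqr_d9 : C := (l1 ^+ 2 - l1 + 1) * (l2 ^+ 2 - l2 + 1).
Definition numA9 : C :=
  (2%:R * l1 * l2 - l1 - l2 + 2%:R) * (l1 * l2 + l1 - 2%:R * l2 + 1)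
  * (l1 * l2 - 2%:R * l1 + l2 + 1).
Definition numB9 : C :=
  (2%:R * l1 * l2 - l1 - l2 - 1) * (l1 * l2 + l1 + l2 - 2%:R)
  * (l1 * l2 - 2%:R * l1 - 2%:R * l2 + 1).

Definition J9_G2 : {poly C} :=
  (4%:R / 3%:R * sqr_d9) *: ('X ^+ 2 * ('X - 1) ^+ 4).
Definition J9_G3 : {poly C} :=
  - (4%:R / 27%:R) *: ('X ^+ 3 * ('X - 1) ^+ 5 * (numB9 *: 'X - numA9%:P)).

(* The equation of J_9 is
     y^2 = x (x - e u (u - 1)^2) (x - f u (u - 1)^2) - c u^3 (u - 1)^5,
   c = l1 l2 (l1 - 1) (l2 - 1), if p = (r / 3) u (u - 1)^2 with r = e + f in
   the list.  The term m allows for a translation of u10 = x / (u - 1)^2.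
   These p are exactly the ones for which y10^2 is a monic cubic in x10 over
   C[u10], with u10, x10, y10 as in the main statement. *)
Definition J9_shift (p : {poly C}) : Prop :=
  exists r m : C,
    [/\ r \in [:: 2%:R * l1 * l2 - l1 - l2 - 1;
                  2%:R - l1 * l2 - l1 - l2;
                  2%:R * l1 + 2%:R * l2 - l1 * l2 - 1],
        rational_in l1 l2 m
      & p = ((r / 3%:R) *: 'X + m%:P) * ('X - 1) ^+ 2].

Definition J9 (p : {poly C}) : {poly {poly C}} := normal_form J9_G2 J9_G3 p.

End NormalForms.

(* The polynomials G2 and G3 above are those of the normal forms written with
   the functions t and T. *)
Section NormalFormsCheck.
Variables (C : numFieldType) (l1 l2 d u : C).
Hypotheses (d0 : d != 0) (u1 : u != 1).

Let u1' : u - 1 != 0. Proof. by rewrite subr_eq0. Qed.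

Let hE := (hornerZ, hornerM, hornerD, hornerN, horner_exp, hornerC, hornerX,
  hornerXsubC).

Section J7.
Hypothesis d_sqr : d ^+ 2 = l1 * l2.
Let t : C :=
  ((l1 * l2 + 1) * u - l1 - l2) / (4%:R * d * (u - 1)) + 2%:R^-1.
Let T : C := d * u * (u - 1) ^+ 2.

Lemma J7_G2E :
  (J7_G2 l1 l2).[u]
  = 3%:R^-1 * (64%:R * t ^+ 2 - 64%:R * t + 4%:R) * T ^+ 2.
Proof.
rewrite /J7_G2 /N7 -polyC1 !hE /t /T -!d_sqr.
by field; rewrite d0 u1'.
Qed.

Lemma J7_G3E :
  (J7_G3 l1 l2).[u]
  = 8%:R / 27%:R * (2%:R * t - 1) * (32%:R * t ^+ 2 - 32%:R * t - 1) * T ^+ 3.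
Proof.
rewrite /J7_G3 /N7 -polyC1 !hE /t /T -!d_sqr.
by field; rewrite d0 u1'.
Qed.
End J7.

Section J9.
Hypothesis d_sqr : d ^+ 2 = sqr_d9 l1 l2.
Let A : C := numA9 l1 l2 / (4%:R * d ^+ 3) + 2%:R^-1.
Let B : C := numB9 l1 l2 / (4%:R * d ^+ 3) + 2%:R^-1.
Let t : C := (B * u - A) / (u - 1).
Let T : C := - (2%:R / 3%:R) * d * u * (u - 1) ^+ 2.

Lemma J9_G2E : (J9_G2 l1 l2).[u] = 3%:R * T ^+ 2.
Proof.
rewrite /J9_G2 -polyC1 !hE /T -d_sqr.
by field.
Qed.

Lemma J9_G3E : (J9_G3 l1 l2).[u] = (2%:R * t - 1) * T ^+ 3.
Proof.
rewrite /J9_G3 -polyC1 !hE /t /T /A /B.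
by field; rewrite d0 u1'.
Qed.
End J9.

End NormalFormsCheck.

(* Main.v *)
(** With p = (l1 - 1) (l2 - 1), q = l1 l2 and c = p q, eliminating (u_7, x_7),
    resp. (u_9, x_9), turns the given equation into y^2 = f(u, x) with
      f_8  = x (x^2 + u (2 - (p + q + 1) u) x
                + u^2 (1 - p u) (1 - u) (1 - q u)),
      f_11 = x (x - p u^2) (x - (q + 1) u^2) + l2 u (x - p u^2)^2 + l1 u^3 x^2,
      f_10 = x^3 + v (v - e) (v - f) x^2 + c v^2 (2 v - e - f) x + c^2 v^3,
    where v = u - m, and e + f is the r of J9_shift.  The fibres at u = 0
    (v = 0) and u = oo, and all those of f_8, are read off the orders of c4, c6
    and the discriminant.  The discriminants of f_10 and f_11 have four more
    roots.  The surface y^2 = f(u, x) is smooth over them, so that each is an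
    I_1 (nodal cubic, simple root) or a II (cuspidal cubic, double root).
    A degeneration that is not a collision would make l2 one of the six values
    at which the two curves are isomorphic.

    The transformations preserve algebraic independence because each of them is
    a sequence of steps x := h(u) x, x := x + h(u), x := 1 / x, u <-> x. *)
From HB Require Import structures.
Require Import Defs.
From mathcomp Require Import all_boot all_order all_algebra.
From mathcomp Require Import polyXY complex reals.
From mathcomp Require Import ring zify.

Set Implicit Arguments.
Unset Strict Implicit.
Unset Printing Implicit Defensive.

Import Order.TTheory GRing.Theory Num.Theory.
Local Open Scope ring_scope.

(** * Evaluation and algebraic independence *)

(** The four movable roots of the discriminants of f_10 and f_11 are roots of a quartic with no
    usable factorization, so the fibres there are never computed one by one. Smoothness replaces the
    computation: at a multiple root of the cubic, the derivative of the discriminant (node) or of c6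
    (cusp) is a nonzero multiple of the derivative of f in u, which smoothness makes nonzero.
    Smoothness itself is checked in the coordinate T = x / (u - m), resp. T = x / u^2, where a
    common power of the base coordinate drops out. Multiplicities 1 and 2 add up to 4 in only three
    ways. A double root of the quartic is a cusp, hence a triple root of the cubic; eliminating that
    root and the base point leaves one condition on the parameters, and these conditions are the
    last four factors of [degeneracy]. *)

Section Evaluation.
Variables (C K : fieldType) (iota : {rmorphism C -> K}) (u x : K).

Lemma ev1D f g : ev1 iota (f + g) u = ev1 iota f u + ev1 iota g u.
Proof. by rewrite /ev1 rmorphD hornerD. Qed.
Lemma ev1N f : ev1 iota (- f) u = - ev1 iota f u.
Proof. by rewrite /ev1 rmorphN hornerN. Qed.
Lemma ev1M f g : ev1 iota (f * g) u = ev1 iota f u * ev1 iota g u.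
Proof. by rewrite /ev1 rmorphM hornerM. Qed.
Lemma ev1Xn f n : ev1 iota (f ^+ n) u = ev1 iota f u ^+ n.
Proof. by rewrite /ev1 rmorphXn horner_exp. Qed.
Lemma ev1C c : ev1 iota c%:P u = iota c.
Proof. by rewrite /ev1 map_polyC hornerC. Qed.
Lemma ev1X : ev1 iota 'X u = u.
Proof. by rewrite /ev1 map_polyX hornerX. Qed.
Lemma ev1Z c f : ev1 iota (c *: f) u = iota c * ev1 iota f u.
Proof. by rewrite -mul_polyC ev1M ev1C. Qed.
Lemma ev1_0 : ev1 iota 0 u = 0.
Proof. by rewrite /ev1 rmorph0 horner0. Qed.
Lemma ev1_1 : ev1 iota 1 u = 1.
Proof. by rewrite /ev1 rmorph1 hornerC. Qed.
Definition ev1E :=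
  (ev1_1, ev1_0, ev1X, ev1Z, ev1C, ev1Xn, ev1M, ev1D, ev1N).

(** The closure inside [ev2] is named and declared a ring morphism so that the general facts on
    [map_poly] apply to [ev2]. *)
Let ev1u := fun c : {poly C} => ev1 iota c u.
Let ev1u_zmod : zmod_morphism ev1u.
Proof. by move=> f g; rewrite /ev1u ev1D ev1N. Qed.
Let ev1u_monoid : monoid_morphism ev1u.
Proof. by split=> [|f g]; rewrite /ev1u (ev1_1, ev1M). Qed.
HB.instance Definition _ := GRing.isZmodMorphism.Build _ _ ev1u ev1u_zmod.
HB.instance Definition _ := GRing.isMonoidMorphism.Build _ _ ev1u ev1u_monoid.

Lemma ev2D f g : ev2 iota (f + g) u x = ev2 iota f u x + ev2 iota g u x.
Proof. by rewrite /ev2 -/ev1u rmorphD hornerD. Qed.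
Lemma ev2N f : ev2 iota (- f) u x = - ev2 iota f u x.
Proof. by rewrite /ev2 -/ev1u rmorphN hornerN. Qed.
Lemma ev2M f g : ev2 iota (f * g) u x = ev2 iota f u x * ev2 iota g u x.
Proof. by rewrite /ev2 -/ev1u rmorphM hornerM. Qed.
Lemma ev2Xn f n : ev2 iota (f ^+ n) u x = ev2 iota f u x ^+ n.
Proof. by rewrite /ev2 -/ev1u rmorphXn horner_exp. Qed.
Lemma ev2C f : ev2 iota f%:P u x = ev1 iota f u.
Proof. by rewrite /ev2 -/ev1u map_polyC hornerC. Qed.
Lemma ev2X : ev2 iota 'X u x = x.
Proof. by rewrite /ev2 -/ev1u map_polyX hornerX. Qed.
Definition ev2E := (ev2X, ev2C, ev2Xn, ev2M, ev2D, ev2N).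

Lemma ev2_sum (f : {poly {poly C}}) n : (size f <= n)%N ->
  ev2 iota f u x = \sum_(i < n) ev1 iota f`_i u * x ^+ i.
Proof.
move=> sf; rewrite /ev2 -/ev1u (@horner_coef_wide _ n).
  by apply: eq_bigr => i _; rewrite coef_map.
by apply: leq_trans sf; apply: size_poly.
Qed.

End Evaluation.

Section AlgIndep.
Variables (C K : fieldType) (iota : {rmorphism C -> K}).
Implicit Types (u x : K) (h : {poly C}).

Lemma alg_indep_ev1_neq0 u x h : alg_indep iota u x -> h != 0 ->
  ev1 iota h u != 0.
Proof. by move=> ux h0; rewrite -(ev2C iota u x) ux ?polyC_eq0. Qed.

Lemma alg_indep_sub_neq0 u x h : alg_indep iota u x -> x - ev1 iota h u != 0.
Proof.
by move=> /(_ ('X - h%:P)); rewrite polyXsubC_eq0 !ev2E; apply.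
Qed.

Lemma alg_indep_swap u x : alg_indep iota u x -> alg_indep iota x u.
Proof.
move=> ux f f0; have := ux (swapXY f); rewrite swapXY_eq0 => /(_ f0).
(* A common bound on both degrees turns the two evaluations into double sums over one square, equal
   after exchanging the summations. *)
congr (_ != 0); pose n := maxn (size f) (size (swapXY f)).
have sf : (size f <= n)%N by rewrite leq_maxl.
have ss : (size (swapXY f) <= n)%N by rewrite leq_maxr.
rewrite (ev2_sum _ _ _ sf) (ev2_sum _ _ _ ss).
have E (g : {poly {poly C}}) (v : K) i : (size (swapXY g) <= n)%N ->
    ev1 iota g`_i v = \sum_(j < n) iota g`_i`_j * v ^+ j.
  move=> sg; rewrite /ev1 (@horner_coef_wide _ n).
    by apply: eq_bigr => j _; rewrite coef_map.
  apply: leq_trans (size_poly _ _) _; apply: leq_trans _ sg.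
  by rewrite -sizeYE; apply: max_size_coefXY.
under eq_bigr => i _ do rewrite E ?swapXYK // mulr_suml.
rewrite exchange_big; apply: eq_bigr => j _.
rewrite E // mulr_suml; apply: eq_bigr => i _.
by rewrite coef_swapXY mulrAC.
Qed.

Lemma alg_indep_shift u x h : alg_indep iota u x ->
  alg_indep iota u (x + ev1 iota h u).
Proof.
move=> ux f f0; pose g := f \Po ('X + h%:P).
have -> : ev2 iota f u (x + ev1 iota h u) = ev2 iota g u x.
  rewrite /g; elim/poly_ind: (f) => [|k c IH].
    by rewrite comp_poly0 /ev2 rmorph0 !horner0.
  by rewrite comp_polyD comp_polyM comp_polyX comp_polyC !ev2E IH.
apply: ux; rewrite /g -size_poly_eq0 size_comp_poly2 ?size_poly_eq0 //.
exact: size_XaddC.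
Qed.

Lemma alg_indep_scale u x h : h != 0 -> alg_indep iota u x ->
  alg_indep iota u (ev1 iota h u * x).
Proof.
move=> h0 ux f f0; pose g := \poly_(i < size f) (f`_i * h ^+ i).
have -> : ev2 iota f u (ev1 iota h u * x) = ev2 iota g u x.
  rewrite (ev2_sum _ _ _ (leqnn _)) (ev2_sum _ _ _ (size_poly _ _)).
  apply: eq_bigr => i _; rewrite coef_poly ltn_ord ev1M ev1Xn exprMn.
  by rewrite mulrA.
apply: ux; apply: contra_neq f0 => /polyP g0; apply/polyP => i.
have := g0 i; rewrite coef_poly !coef0; case: ltnP =>
  [_|/(nth_default 0) -> //].
by move/eqP; rewrite mulf_eq0 expf_eq0 (negPf h0) andbF orbF => /eqP.
Qed.

Lemma alg_indep_inv u x : alg_indep iota u x -> alg_indep iota u x^-1.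
Proof.
move=> ux f f0; have x0 : x != 0.
  by have := ux 'X; rewrite polyX_eq0 ev2X; apply.
(* The reversed polynomial x^(n-1) f(1/x); its constant coefficient is the leading coefficient of
   [f], so it is nonzero. *)
pose n := size f; pose g := \poly_(i < n) f`_(n - i.+1).
suff E : ev2 iota g u x = ev2 iota f u x^-1 * x ^+ n.-1.
  have : ev2 iota g u x != 0.
    apply: ux; apply: contra_neq f0 => /polyP g0.
    apply/eqP; rewrite -lead_coef_eq0 lead_coefE -/n; have := g0 0%N.
    rewrite coef_poly coef0; case: ltnP => [_ |]; first by rewrite subn1 => ->.
    by rewrite leqn0 => /eqP sf; rewrite nth_default ?sf // -/n sf.
  by rewrite E; apply: contra_neq => ->; rewrite mul0r.
rewrite (@ev2_sum _ _ _ _ _ f n (leqnn _)) (@ev2_sum _ _ _ _ _ g n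
  (size_poly _ _)).
rewrite [RHS]mulr_suml (reindex_inj rev_ord_inj); apply: eq_bigr => i _ /=.
rewrite coef_poly ltn_subrL /= (leq_ltn_trans _ (ltn_ord i)) //.
rewrite subnSK // subKn ?[(i <= n)%N]ltnW // -mulrA; congr (_ * _).
rewrite -[n.-1](@subnK i) ?exprD; last first.
  by rewrite -ltnS prednK ?(leq_ltn_trans _ (ltn_ord i)).
rewrite mulrCA exprVn mulVf ?expf_neq0 // mulr1; congr (_ ^+ _).
by rewrite -subn1 -subnDA add1n.
Qed.

End AlgIndep.

(** * Isomorphic Legendre curves *)

Section Isogeny.
Variable C : numClosedFieldType.
Implicit Types l m r s : C.

(* x |-> r x + s, y |-> r^(3/2) y is an isomorphism of the curves. *)
Lemma isogenous_affine l m r s : r != 0 ->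
  (forall x, r ^+ 3 * (x * (x - 1) * (x - l))
             = (r * x + s) * (r * x + s - 1) * (r * x + s - m)) ->
  isogenous l m.
Proof.
move=> r0 E; exists (r *: 'X + s%:P), 0, 0, (sqrtC (r ^+ 3))%:P, 1.
split; first exact: oner_neq0.
  exists (r ^+ 3)%:P%:P.
  have EP : (r ^+ 3)%:P * legendre l = (r *: 'X + s%:P)
      * (r *: 'X + s%:P - 1) * (r *: 'X + s%:P - m%:P).
    apply/eqP; rewrite -subr_eq0; apply/negPn/negP => P0.
    have [x] := @closed_nonrootP _ _ P0.
    by rewrite /root /legendre !hornerE -E !mulrA subrr eqxx.
  have Es : (sqrtC (r ^+ 3))%:P ^+ 2 = (r ^+ 3)%:P :> {poly C}.
    by rewrite -polyC_exp sqrtCK.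
    rewrite !(polyC0, polyC1, mul0r, addr0, add0r, mulr1) exprMn -polyC_exp Es.
  by rewrite [RHS]mulrBr -polyCM EP !polyCM !polyCB polyC1.
by apply/orP; left; rewrite -mul_polyC size_MXaddC polyC_eq0
  (negPf r0) size_poly1 size_polyC r0.
Qed.

(* The six values of m for which the curves have the same j-invariant. *)
Lemma isogenous_orbit l m : l != 0 -> l != 1 ->
  [|| m == l, l + m == 1, l * m == 1, l * m == l + m, m * (1 - l) == 1
    | l * m == l - 1] -> isogenous l m.
Proof.
move=> l0 l1; have l1' : 1 - l != 0 by rewrite subr_eq0 eq_sym.
have l1'' : l - 1 != 0 by rewrite subr_eq0.
case/or4P=> [/eqP->|/eqP E|/eqP E|].
- by apply: (@isogenous_affine _ _ 1 0); rewrite ?oner_neq0 // => x; ring.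
- have -> : m = 1 - l by rewrite -E; ring.
  apply: (@isogenous_affine _ _ (-1) 1); rewrite ?oppr_eq0 ?oner_neq0 // => x.
  by ring.
- have -> : m = l^-1 by rewrite -[LHS](mulKf l0) E mulr1.
  by apply: (@isogenous_affine _ _ l^-1 0); rewrite ?invr_eq0 // => x; field.
case/or3P=> /eqP E.
- have -> : m = l / (l - 1) by apply: (mulIf l1'');
  rewrite mulrBr [m * l]mulrC E; field.
  apply: (@isogenous_affine _ _ (1 - l)^-1 (l / (l - 1))).
    by rewrite invr_eq0.
  by move=> x; field; rewrite l1' l1''.
- have -> : m = (1 - l)^-1 by rewrite -[LHS](mulfK l1') E mul1r.
  apply: (@isogenous_affine _ _ (l - 1)^-1 (1 - l)^-1).
    by rewrite invr_eq0.
  by move=> x; field; rewrite l1' l1''.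
have -> : m = (l - 1) / l by rewrite -E mulrC mulKf.
apply: (@isogenous_affine _ _ (- l^-1) 1); first by rewrite oppr_eq0 invr_eq0.
by move=> x; field.
Qed.
End Isogeny.

(** * Orders and fibres *)

Section PolyRules.
Variables (R : comNzRingType) (x : R).
Lemma horner1 : (1 : {poly R}).[x] = 1. Proof. by rewrite -polyC1 hornerC. Qed.
Lemma horner_nat n : (n%:R : {poly R}).[x] = n%:R.
Proof. by rewrite -polyC_natr hornerC. Qed.
Lemma deriv_nat n : (n%:R : {poly R})^`() = 0.
Proof. by rewrite -polyC_natr derivC. Qed.
Definition polyE := (horner1, horner_nat, horner_exp, hornerZ, hornerC, hornerX,
  hornerM, hornerD, hornerN, horner0).
Definition derE := (deriv_nat, derivC, derivX, deriv_exp, derivM, derivD,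
  derivN).
End PolyRules.

(** * Orders at finite places, and degrees as orders at infinity *)

Section Orders.
Variable C : fieldType.
Implicit Types (v a c : C) (p q : {poly C}) (w : option C).

Lemma mup_XsubCX_mul v n q : q.[v] != 0 -> mup v (('X - v%:P) ^+ n * q) = n.
Proof. by move=> qv; rewrite mupMl ?mup_XsubCX ?eqxx // -rootE. Qed.

Lemma ord_eq_finite v n p q : p = ('X - v%:P) ^+ n * q -> q.[v] != 0 ->
  ord_eq (Some v) p n%:Z.
Proof.
move=> -> qv; rewrite /ord_eq /ord mup_XsubCX_mul // eqxx andbT.
rewrite mulf_neq0 ?expf_neq0 ?polyXsubC_eq0 //.
by apply: contraNneq qv => ->; rewrite horner0.
Qed.

Lemma ord_ge_finite v n p q : p = ('X - v%:P) ^+ n * q ->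
  ord_ge (Some v) p n%:Z.
Proof.
move=> pE; rewrite /ord_ge /ord; case: eqP => //= /eqP p0.
by rewrite lez_nat mup_geq // pE dvdp_mulr.
Qed.

Lemma ord_ge_finite0 v p : ord_ge (Some v) p 0.
Proof. by apply: (@ord_ge_finite v 0 p p); rewrite expr0 mul1r. Qed.

Lemma ord_eq_ge w p (m n : int) : ord_eq w p m -> ord_ge w p n = (n <= m).
Proof. by case/andP=> p0 /eqP pm; rewrite /ord_ge (negPf p0) pm. Qed.

Lemma ord_ge_trans w p (m n : int) : n <= m -> ord_ge w p m -> ord_ge w p n.
Proof.
by move=> nm; rewrite /ord_ge => /orP[->//|pm]; rewrite (le_trans nm pm) orbT.
Qed.

(** The degree is only bounded and [c] may be zero: in this form the notion passes to sums and
    products without excluding cancellation, and [c != 0] is checked once, at the end. *)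
Definition top (n : nat) c p := (size p <= n.+1)%N /\ p`_n = c.

Lemma topX : top 1 1 'X.
Proof. by rewrite /top size_polyX coefX. Qed.
Lemma topC c : top 0 c c%:P.
Proof. by rewrite /top size_polyC_leq1 coefC. Qed.
(** Pads a summand of lower degree, raising its formal degree by k + 1, so that [topD] can add it to
    the dominant one. *)
Lemma topW n k c p : top n c p -> top (n + k).+1 0 p.
Proof.
case=> sp _; have sp' : (size p <= (n + k).+1)%N.
  by rewrite (leq_trans sp) // ltnS leq_addr.
by split; [exact: leqW | exact: nth_default].
Qed.
Lemma topD n c d p q : top n c p -> top n d q -> top n (c + d) (p + q).
Proof.
move=> [sp <-] [sq <-]; split; last by rewrite coefD.
by rewrite (leq_trans (size_polyD _ _)) // geq_max sp.
Qed.
Lemma topN n c p : top n c p -> top n (- c) (- p).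
Proof. by move=> [sp <-]; rewrite /top size_polyN coefN. Qed.
Lemma topM m n c d p q : top m c p -> top n d q -> top (m + n) (c * d) (p * q).
Proof.
move=> [sp <-] [sq <-]; split.
  apply: leq_trans (size_polyMleq _ _) _.
  by move: sp sq; move: (size p) (size q) => a b; lia.
rewrite coefM (bigD1 (inord m)) //= big1 => [|i].
  by rewrite inordK ?addKn ?addr0 //; lia.
rewrite -val_eqE /= inordK; last by lia.
case: (ltngtP i m) => // im _.
  by rewrite [q`__]nth_default ?mulr0 // (leq_trans sq) //; lia.
by rewrite nth_default ?mul0r // (leq_trans sp).
Qed.
Lemma topXn m k c p : top m c p -> top (m * k) (c ^+ k) (p ^+ k).
Proof.
move=> tp; elim: k => [|k IH]; first by rewrite muln0 !expr0 -polyC1;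
  apply: topC.
by rewrite mulnS !exprS; apply: topM.
Qed.

Lemma ord_eq_infinite n c p : top n c p -> c != 0 -> ord_eq None p (- n%:Z).
Proof.
move=> [sp pn] c0; have sE : size p = n.+1.
  apply/eqP; rewrite eqn_leq sp ltnNge; apply: contra c0 => sn.
  by rewrite -pn nth_default.
by rewrite /ord_eq /ord -size_poly_eq0 sE eqxx.
Qed.

Lemma ord_ge_infinite n c p : top n c p -> ord_ge None p (- n%:Z).
Proof. by case=> sp _; rewrite /ord_ge /ord; apply/orP; right; lia. Qed.

End Orders.

Section Cubics.
Variable C : fieldType.
Implicit Types (v : C) (A B G q : {poly C}).

Definition wcubic A B G : {poly {poly C}} :=
  'X^3 + A%:P * 'X^2 + B%:P * 'X + G%:P.

Lemma wcubicE A B G : wcubic A B G = Poly [:: G; B; A; 1].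
Proof. by rewrite /= !cons_poly_def mul0r add0r /wcubic polyC1; ring. Qed.

Lemma coef_wcubic A B G i : (wcubic A B G)`_i = [:: G; B; A; 1]`_i.
Proof. by rewrite wcubicE coef_Poly. Qed.

Lemma size_wcubic A B G : size (wcubic A B G) = 4%N.
Proof. by rewrite wcubicE (@PolyK _ 0) //= oner_neq0. Qed.

Lemma wcubic_monic A B G : wcubic A B G \is monic.
Proof. by rewrite monicE lead_coefE size_wcubic coef_wcubic. Qed.

Lemma c4_wcubic A B G : inv_c4 (wcubic A B G) = 16%:R * (A ^+ 2 - 3%:R * B).
Proof. by rewrite /inv_c4 !coef_wcubic /=; ring. Qed.

Lemma c6_wcubic A B G : inv_c6 (wcubic A B G)
  = - 32%:R * (2%:R * A ^+ 3 - 9%:R * A * B + 27%:R * G).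
Proof. by rewrite /inv_c6 !coef_wcubic /=; ring. Qed.

Lemma disc_wcubic A B G : inv_disc (wcubic A B G)
  = 16%:R * (A ^+ 2 * B ^+ 2 - 4%:R * A ^+ 3 * G - 4%:R * B ^+ 3
     + 18%:R * A * B * G - 27%:R * G ^+ 2).
Proof. by rewrite /inv_disc !coef_wcubic /=. Qed.

Lemma inv_relation f :
  1728%:R * inv_disc f = inv_c4 f ^+ 3 - inv_c6 f ^+ 2 :> {poly C}.
Proof. rewrite /inv_c4 /inv_c6 /inv_disc; ring. Qed.
End Cubics.

Section Fibres.
Variable C : numFieldType.
Implicit Types (v : C) (A B G q : {poly C}) (f : {poly {poly C}}).

(** The index is off by one in every use: [natr_neq0 C 15] says that 16 is nonzero. *)
Lemma natr_neq0 n : n.+1%:R != 0 :> C.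
Proof. by rewrite pnatr_eq0. Qed.

(** By 1728 disc = c4^3 - c6^2. Hence an equation whose discriminant has order below 12 is minimal,
    which justifies k = 0 at all finite places. *)
Lemma disc_order v f : inv_disc f != 0 ->
  ord_ge (Some v) (inv_c4 f) 4 -> ord_ge (Some v) (inv_c6 f) 6 ->
  (12 <= mup v (inv_disc f))%N.
Proof.
move=> D0 g4 g6.
have dvd p n : ord_ge (Some v) p n%:Z -> ('X - v%:P) ^+ n %| p.
  rewrite /ord_ge /ord; case: eqP => [-> _|/eqP p0 /=]; first exact: dvdp0.
  by rewrite lez_nat mup_geq.
rewrite mup_geq // -(@dvdpZr _ 1728%:R) ?natr_neq0 //.
rewrite -mul_polyC polyC_natr inv_relation.
apply: dvdp_sub.
  by rewrite -[12%N]/(4 * 3)%N exprM dvdp_exp2r // dvd.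
by rewrite -[12%N]/(6 * 2)%N exprM dvdp_exp2r // dvd.
Qed.

Lemma minimal_finite v f n : (n < 12)%N -> ord_eq (Some v) (inv_disc f) n%:Z ->
  ~~ (ord_ge (Some v) (inv_c4 f) 4 && ord_ge (Some v) (inv_c6 f) 6).
Proof.
move=> n12 /andP[D0 /eqP[mn]]; apply/negP => /andP[g4 g6].
by have := disc_order D0 g4 g6; lia.
Qed.

Lemma has_fibre_I0 v f : (inv_disc f).[v] != 0 -> has_fibre f (Some v) (KI 0).
Proof.
move=> Dv; have eD : ord_eq (Some v) (inv_disc f) 0.
  by apply: (@ord_eq_finite _ v 0 _ (inv_disc f)); rewrite ?expr0 ?mul1r.
exists 0; split=> //; try exact: ord_ge_finite0.
exact: minimal_finite eD.
Qed.

Lemma has_fibre_I v f n q : (inv_c4 f).[v] != 0 ->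
  inv_disc f = ('X - v%:P) ^+ n.+1 * q -> q.[v] != 0 ->
  has_fibre f (Some v) (KI n.+1).
Proof.
move=> c4v Dq qv.
have e4 : ord_eq (Some v) (inv_c4 f) 0.
  by apply: (@ord_eq_finite _ v 0 _ (inv_c4 f)); rewrite ?expr0 ?mul1r.
exists 0; split=> //; try exact: ord_ge_finite0.
  by rewrite (ord_eq_ge _ e4).
by rewrite e4 (ord_eq_finite Dq).
Qed.

(** In c4^3 - c6^2 the cube has order at least 3 and the square order exactly 2. The multiplicity is
    part of the conclusion because the roots of the discriminant are counted later. *)
Lemma has_fibre_II v f q4 q6 : inv_c4 f = ('X - v%:P) * q4 ->
  inv_c6 f = ('X - v%:P) * q6 -> q6.[v] != 0 ->
  mup v (inv_disc f) = 2%N /\ has_fibre f (Some v) KII.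
Proof.
move=> E4 E6 q6v; pose q := 1728%:R^-1 *: (('X - v%:P) * q4 ^+ 3 - q6 ^+ 2).
have Dq : inv_disc f = ('X - v%:P) ^+ 2 * q.
  apply: (@mulfI _ 1728%:R); first by rewrite -polyC_natr polyC_eq0 natr_neq0.
  rewrite inv_relation E4 E6 /q -mul_polyC mulrCA [X in _ = _ * X]mulrA.
  by rewrite -polyC_natr -polyCM divff ?natr_neq0 //; ring.
have qv : q.[v] != 0.
  rewrite /q !polyE subrr mul0r sub0r mulf_eq0 negb_or.
  by rewrite oppr_eq0 sqrf_eq0 q6v invr_eq0 natr_neq0.
split; first by rewrite Dq mup_XsubCX_mul.
have eD := ord_eq_finite Dq qv.
have e6 : ord_eq (Some v) (inv_c6 f) 1.
  by apply: (ord_eq_finite _ q6v); rewrite expr1.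
have g4 : ord_ge (Some v) (inv_c4 f) 1.
  by apply: (@ord_ge_finite _ v 1 _ q4); rewrite expr1.
exists 0; split=> //; try exact: ord_ge_finite0.
  exact: minimal_finite eD.
by rewrite g4 e6 eD.
Qed.

Lemma singular_fibres_intro f v0 (t0 t1 : kodaira) (s : seq C)
    (F : C -> kodaira) :
    inv_disc f != 0 -> uniq s -> v0 \notin s ->
    has_fibre f None t1 -> has_fibre f (Some v0) t0 ->
    (forall z, z \in s -> has_fibre f (Some z) (F z)) ->
    (forall z, z != v0 -> z \notin s -> (inv_disc f).[z] != 0) ->
  singular_fibres f (t1 :: t0 :: map F s).
Proof.
move=> D0 us v0s fib1 fib0 fibF fibI0; split=> //.
exists (None :: Some v0 :: map Some s); split.
- rewrite /= !inE /= (mem_map Some_inj) v0s (map_inj_uniq Some_inj) us.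
  by rewrite !andbT; apply/negP => /mapP[].
- by rewrite /= !size_map.
- move=> [|[|i]] //=; rewrite !size_map => si.
  have {}si : (i < size s)%N by [].
  by rewrite (nth_map v0) // (nth_map v0) //; apply: fibF; rewrite mem_nth.
case=> [z|]; rewrite !inE //= (mem_map Some_inj) negb_or => /andP[zv zs].
exact/has_fibre_I0/fibI0.
Qed.

End Fibres.

(** * Fibres at smooth points of the surface *)

Section SmoothSurface.
Variables (C : numClosedFieldType) (A B G : {poly C}).
Let f := wcubic A B G.

(* The surface y^2 = f(u, x) has no singular point on u = v. *)
Definition smooth_at (v : C) := forall x : C,
  x ^+ 3 + A.[v] * x ^+ 2 + B.[v] * x + G.[v] = 0 ->
  3%:R * x ^+ 2 + 2%:R * A.[v] * x + B.[v] = 0 ->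
  A^`().[v] * x ^+ 2 + B^`().[v] * x + G^`().[v] <> 0.

Lemma factor_root (p : {poly C}) (v : C) : p.[v] = 0 ->
  exists q, p = ('X - v%:P) * q /\ q.[v] = p^`().[v].
Proof.
move=> /eqP/factor_theorem[q ->]; exists q; rewrite mulrC; split=> //.
by rewrite derivM derivXsubC !polyE subrr; ring.
Qed.


(** Let w be the derivative of the cubic in u at its multiple root T. At a triple root the
    derivative of c6 is -864 w; at a double root the derivative of the discriminant is -64 (3 T +
    a)^3 w. *)
Lemma smooth_fibre v : smooth_at v -> (inv_disc f).[v] = 0 ->
  (mup v (inv_disc f) = 1%N /\ has_fibre f (Some v) (KI 1)) \/
  [/\ mup v (inv_disc f) = 2%N, has_fibre f (Some v) KII,
      (inv_c4 f).[v] = 0 & (inv_c6 f).[v] = 0].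
Proof.
move=> sm D0; have [Ec4|c40] := eqVneq (inv_c4 f).[v] 0.
  have Ec6 : (inv_c6 f).[v] = 0.
    apply/eqP; rewrite -sqrf_eq0 -horner_exp.
    have /(congr1 (fun p : {poly C} => p.[v])) := inv_relation f.
    rewrite hornerM D0 mulr0 hornerD hornerN [(_ ^+ 3).[v]]horner_exp Ec4.
    by rewrite expr0n /= sub0r => /esym/eqP; rewrite oppr_eq0.
  right; have [q4 [Eq4 q4v]] := factor_root Ec4.
  have [q6 [Eq6 q6v]] := factor_root Ec6.
  have q60 : q6.[v] != 0.
    rewrite q6v; move: Ec4 Ec6.
    rewrite {}/f c4_wcubic c6_wcubic !derE !polyE /= => /eqP.
    rewrite mulf_eq0 (negPf (natr_neq0 C 15)) /= => /eqP Ec4 /eqP.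
    rewrite mulf_eq0 oppr_eq0 (negPf (natr_neq0 C 31)) /= => /eqP Ec6.
    (* T is the triple root. *)
    set a := A.[v] in Ec4 Ec6 *; set b := B.[v] in Ec4 Ec6 *.
    set g := G.[v] in Ec6 *; pose T := - a / 3%:R.
    have n3 := natr_neq0 C 2.
    have n27 := natr_neq0 C 26.
    have aE : a = - 3%:R * T by rewrite /T; field.
    have bE : b = 3%:R * T ^+ 2.
      apply: (mulfI n3); apply/eqP; rewrite eq_sym -subr_eq0 -Ec4 aE.
      by apply/eqP; ring.
    have gE : g = - T ^+ 3.
      apply: (mulfI n27); apply/eqP; rewrite -subr_eq0 -Ec6 aE bE.
      by apply/eqP; ring.
    have := sm T; rewrite -/a -/b -/g aE bE gE => smT.
    have /eqP := smT ltac:(ring) ltac:(ring).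
    move=> w0; rewrite (_ : _ + _ = - 864%:R
        * (A^`().[v] * T ^+ 2 + B^`().[v] * T + G^`().[v])); last by ring.
    by rewrite mulf_neq0 // oppr_eq0 natr_neq0.
  by have [] := has_fibre_II Eq4 Eq6 q60.
left.
have [q [Eq qv]] := factor_root D0.
suff q0 : q.[v] != 0.
  split; first by rewrite Eq -['X - _]expr1 mup_XsubCX_mul.
  by apply: has_fibre_I c40 _ q0; rewrite Eq expr1.
have n2 := natr_neq0 C 1; have n3 := natr_neq0 C 2.
move: c40 D0 qv; rewrite {}/f c4_wcubic disc_wcubic !polyE => c40 D0 ->.
set a := A.[v] in c40 D0 *; set b := B.[v] in c40 D0 *; set g := G.[v] in D0 *.
(* T is the double root; the third root is - a - 2 T, and 3 T + a != 0 is the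
   difference of the two. *)
have M0 : a ^+ 2 - 3%:R * b != 0.
  by apply: contra_neq c40 => ->; rewrite mulr0.
(* The root of the linear remainder of the cubic modulo its derivative. Once denominators are
   cleared, the cubic and its derivative at this point are multiples of the discriminant. *)
pose T := (9%:R * g - a * b) / (2%:R * (a ^+ 2 - 3%:R * b)).
have D0' : a ^+ 2 * b ^+ 2 - 4%:R * a ^+ 3 * g - 4%:R * b ^+ 3
     + 18%:R * a * b * g - 27%:R * g ^+ 2 = 0.
  by move/eqP: D0; rewrite mulf_eq0 (negPf (natr_neq0 C 15)) => /eqP.
have T1 : T ^+ 3 + a * T ^+ 2 + b * T + g = 0.
  apply/eqP; rewrite -(mulIr_eq0 _ (mulIf M0)) -(mulIr_eq0 _
    (mulIf M0)) -(mulIr_eq0 _ (mulIf M0)).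
  rewrite (_ : _ * _ = - (2%:R * a ^+ 3 - 9%:R * a * b + 27%:R * g) / 8%:R * 
   (a ^+ 2 * b ^+ 2 - 4%:R * a ^+ 3 * g - 4%:R * b ^+ 3
     + 18%:R * a * b * g - 27%:R * g ^+ 2)); first by rewrite D0' mulr0.
  by rewrite /T; field; rewrite ?M0 ?n2.
have T2 : 3%:R * T ^+ 2 + 2%:R * a * T + b = 0.
  apply/eqP; rewrite -(mulIr_eq0 _ (mulIf M0)) -(mulIr_eq0 _ (mulIf M0)).
  rewrite (_ : _ * _ = - 9%:R / 4%:R * 
   (a ^+ 2 * b ^+ 2 - 4%:R * a ^+ 3 * g - 4%:R * b ^+ 3
     + 18%:R * a * b * g - 27%:R * g ^+ 2)); first by rewrite D0' mulr0.
  by rewrite /T; field; rewrite ?M0 ?n2.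
have := sm T T1 T2; set w := (X in X <> 0) => /eqP w0.
have bE : b = - (3%:R * T ^+ 2 + 2%:R * a * T).
  by apply/eqP; rewrite -subr_eq0 opprK addrC T2.
have gE : g = - (T ^+ 3 + a * T ^+ 2 + b * T).
  by apply/eqP; rewrite -subr_eq0 opprK addrC T1.
have Ta : 3%:R * T + a != 0.
  apply: contra_neq M0 => Ta; rewrite (_ : _ - _ = (3%:R * T + a) ^+ 2).
    by rewrite Ta expr0n.
  by rewrite bE; ring.
rewrite !derE !polyE -/a -/b -/g /=.
rewrite (_ : _ + _ = - 64%:R * (3%:R * T + a) ^+ 3 * w).
  by rewrite !mulf_neq0 ?expf_neq0 // oppr_eq0 natr_neq0.
by rewrite /w gE bE; ring.
Qed.

Variables (v0 : C) (k : nat) (Q : {poly C}) (t0 t1 : kodaira).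
Hypotheses (discE : inv_disc f = ('X - v0%:P) ^+ k * Q) (sQ : size Q = 5%N)
  (Q0 : Q.[v0] != 0) (smooth : forall v, v != v0 -> smooth_at v)
  (fib1 : has_fibre f None t1) (fib0 : has_fibre f (Some v0) t0).

Let Qn0 : Q != 0. Proof. by rewrite -size_poly_eq0 sQ. Qed.

Lemma quartic_disc_neq0 : inv_disc f != 0.
Proof. by rewrite discE mulf_neq0 // expf_neq0 // polyXsubC_eq0. Qed.

(** The list keeps multiplicities ([size Q = 5] is degree 4), so a count in [rs] is an order of the
    discriminant. *)
Lemma quartic_roots : exists2 rs : seq C, size rs = 4%N & v0 \notin rs /\
  forall z, z != v0 -> mup z (inv_disc f) = count_mem z rs.
Proof.
have [rs QE] := closed_field_poly_normal Q; exists rs.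
  apply: succn_inj; rewrite -sQ QE size_scale ?lead_coef_eq0 //.
  by rewrite size_prod_XsubC.
have lcQ z : ~~ root (lead_coef Q)%:P z by rewrite rootC lead_coef_eq0.
split=> [|z zv].
  by move: Q0; rewrite QE -rootE rootZ ?lead_coef_eq0 // root_prod_XsubC.
rewrite discE mupMr; last first.
  by rewrite rootE !polyE expf_eq0 subr_eq0 (negPf zv) andbF.
by rewrite {1}QE -mul_polyC mupMr // mu_prod_XsubC.
Qed.

Lemma quartic_fibres (rs s : seq C) (F : C -> kodaira) :
    v0 \notin rs -> (forall z, z != v0 -> mup z (inv_disc f)
      = count_mem z rs) ->
    uniq s -> s =i rs ->
    (forall z, z \in rs -> has_fibre f (Some z) (F z)) ->
  singular_fibres f (t1 :: t0 :: map F s).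
Proof.
move=> v0rs mupE us srs fibF.
apply: (@singular_fibres_intro _ f v0); rewrite ?srs ?quartic_disc_neq0 //.
  by move=> z zs; apply: fibF; rewrite -srs.
move=> z zv; rewrite srs; apply: contra => Dz.
by rewrite -has_pred1 has_count -mupE // -XsubC_dvd
  ?quartic_disc_neq0 // dvdp_XsubCl.
Qed.

(** Without a common zero of c4 and c6 no II can occur, so every root is simple and the four roots
    are distinct. *)
Lemma singular_fibres_quartic :
    (forall v, v != v0 -> (inv_c4 f).[v] = 0 -> (inv_c6 f).[v] <> 0) ->
  singular_fibres f [:: t1; t0; KI 1; KI 1; KI 1; KI 1].
Proof.
move=> nocusp; have [rs srs [v0rs mupE]] := quartic_roots.
have fib z : z \in rs -> count_mem z rs = 1%N /\ has_fibre f (Some z) (KI 1).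
  move=> zrs; have zv : z != v0 by apply: contraNneq v0rs => <-.
  have Dz : (inv_disc f).[z] = 0.
    apply/eqP; rewrite -/(root _ z) -dvdp_XsubCl XsubC_dvd
      ?quartic_disc_neq0 //.
    by rewrite mupE // -has_count has_pred1.
  have [[]|[_ _ /(nocusp z zv)//]] := smooth_fibre (smooth zv) Dz.
  by rewrite mupE.
have urs : uniq rs.
  by apply: count_mem_uniq => z; case: (boolP (z \in rs)) =>
    [/fib[]|/count_memPn].
have := quartic_fibres v0rs mupE urs (fun=> erefl) (F := fun=> KI 1).
case: (rs) srs fib => [|? [|? [|? [|? []]]]] //= _ fib; apply=> z zrs.
by have [] := fib z zrs.
Qed.

(** Each root has multiplicity 1 (an I_1) or 2 (a II), so the patterns are 1+1+1+1, 2+1+1 and 2+2;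
    each II absorbs two entries I_1. *)
Lemma singular_fibres_quartic_collision :
  exists2 l, collision [:: t1; t0; KI 1; KI 1; KI 1; KI 1] l &
  singular_fibres f l.
Proof.
have [rs srs [v0rs mupE]] := quartic_roots.
pose F z := if count_mem z rs == 1%N then KI 1 else KII.
have fib z : z \in rs ->
    (count_mem z rs <= 2)%N /\ has_fibre f (Some z) (F z).
  move=> zrs; have zv : z != v0 by apply: contraNneq v0rs => <-.
  have Dz : (inv_disc f).[z] = 0.
    apply/eqP; rewrite -/(root _ z) -dvdp_XsubCl XsubC_dvd
      ?quartic_disc_neq0 //.
    by rewrite mupE // -has_count has_pred1.
  by rewrite /F; have [[]|[]] := smooth_fibre (smooth zv) Dz;
    rewrite mupE // => ->.
have fibs s us srs' :=
  @quartic_fibres rs s F v0rs mupE us srs' (fun z zrs => (fib z zrs).2).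
have [/allP cnt1|/allPn[z zrs cz1]] := boolP (all (fun z =>
  count_mem z rs == 1%N) rs).
  exists [:: t1; t0; KI 1; KI 1; KI 1; KI 1]; first exact: collision_none.
  have urs : uniq rs.
    by apply: count_mem_uniq => z; case: (boolP (z \in rs)) =>
      [/cnt1/eqP|/count_memPn].
  have := quartic_fibres v0rs mupE urs (fun=> erefl) (F := fun=> KI 1).
  have : forall z, z \in rs -> has_fibre f (Some z) (KI 1).
    by move=> z zrs; have [_] := fib z zrs; rewrite /F cnt1.
  by case: (rs) srs => [|? [|? [|? [|? []]]]] //= _ fib1' H; exact: H.
have cz : count_mem z rs = 2%N.
  have [] := fib z zrs; move: cz1 zrs; rewrite -has_pred1 has_count.
  by case: count => [|[|[|]]].
(* Removing the double root [z] twice leaves two roots [x] and [y], both different from [z]; they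
   are equal exactly in the pattern 2+2. *)
have prs := perm_to_rem zrs.
have zr : z \in rem z rs.
  rewrite -has_pred1 has_count; move/permP: prs => /(_ (pred1 z)) /=.
  by rewrite cz eqxx add1n => -[<-].
have {}prs : perm_eq rs [:: z, z & rem z (rem z rs)].
  by apply: perm_trans prs _; rewrite perm_cons perm_to_rem.
have := perm_size prs; rewrite srs; move: prs.
case: (rem z (rem z rs)) => [|x [|y []]] //= prs _.
have cnt w : count_mem w rs = ((z == w) + ((z == w) + ((x == w) + ((y == w)
  + 0))))%N.
  by rewrite (permP prs).
have xyrs w : (w \in rs) = [|| w == z, w == z, w == x | w == y].
  by rewrite (perm_mem prs) !inE.
have [] := fib x; first by rewrite xyrs eqxx !orbT.
have [] := fib y; first by rewrite xyrs eqxx !orbT.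
have Fz : F z = KII by rewrite /F cz.
move: cz; rewrite cnt eqxx !add1n => -[].
case: eqP => // xz; case: eqP => // yz _ _ _ _ _.
have [xy|xy] := eqVneq x y.
  exists [:: t1; t0; KII; KII].
    apply: (@collision_II [:: t1; t0] [:: KI 1; KI 1]).
    by apply: (@collision_II [:: t1; t0; KII] [::]); apply: collision_none.
  have := fibs [:: z; x]; rewrite /= Fz /F cnt xy eqxx.
  have -> : (z == y) = false by apply/eqP => zy; apply: yz.
  apply; first by rewrite inE andbT; apply/eqP => zy; apply: yz.
  by move=> w; rewrite xyrs !inE xy; case: (w == z); case: (w == y).
exists [:: t1; t0; KII; KI 1; KI 1].
  by apply: (@collision_II [:: t1; t0] [:: KI 1; KI 1]); apply: collision_none.
have zx : (z == x) = false by apply/eqP => zy; apply: xz.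
have zy : (z == y) = false by apply/eqP => zy; apply: yz.
have := fibs [:: z; x; y]; rewrite /= Fz /F !cnt zx zy !eqxx [y == x]eq_sym
  (negPf xy).
apply; first by rewrite !inE zx zy xy.
by move=> w; rewrite xyrs !inE; case: (w == z).
Qed.
End SmoothSurface.

(** * Singular fibres of f_10 *)

(** [e], [f], [c] and [m] are kept as independent parameters, so that one computation serves the
    three values of [r] in [J9_shift] and every translation. *)
Definition J10_A (C : fieldType) (e f m : C) : {poly C} :=
  ('X - m%:P) * (('X - m%:P - e%:P) * ('X - m%:P - f%:P)).
Definition J10_B (C : fieldType) (e f c m : C) : {poly C} :=
  c%:P * ('X - m%:P) ^+ 2 * (2%:R * ('X - m%:P) - (e + f)%:P).
Definition J10_G (C : fieldType) (c m : C) : {poly C} :=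
  c%:P ^+ 2 * ('X - m%:P) ^+ 3.

Section J10.
Variable C : numClosedFieldType.
Variables e f c m : C.
Hypotheses (c0 : c != 0) (ef : e != f).
Let V : {poly C} := 'X - m%:P.
Let d := e - f.
Let A2 := (V - e%:P) * (V - f%:P).
Let L := 2%:R * V - (e + f)%:P.

Let J10 := wcubic (J10_A e f m) (J10_B e f c m) (J10_G c m).

(** The terms A^2 B^2 and -4 A^3 G of the discriminant combine through L^2 - 4 A2 = d^2; this brings
    the cofactor down from degree 6 to degree 4. *)
Let Q := (16%:R * c ^+ 2)%:P * (d%:P ^+ 2 * A2 ^+ 2 - 4%:R * c%:P * L ^+ 3
  + 18%:R * c%:P * A2 * L - 27%:R * c%:P ^+ 2).

(* Q does not vanish at u = m. *)
Hypothesis Qm : d ^+ 2 * (e * f) ^+ 2 + 4%:R * c * (e + f) ^+ 3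
  - 18%:R * c * (e * f) * (e + f) - 27%:R * c ^+ 2 != 0.

Let discE : inv_disc J10 = V ^+ 6 * Q.
Proof.
rewrite disc_wcubic /J10_A /J10_B /J10_G -/V /Q /A2 /L /d.
by rewrite !(polyCM, polyCB, polyCD, polyC_exp, polyC_natr); ring.
Qed.

Let topV : top 1 1 V.
Proof.
have := topD (topX C) (topW 0 (topC (- m))).
by rewrite addr0 rmorphN.
Qed.
Let topVc x : top 1 1 (V - x%:P).
Proof.
have := topD topV (topW 0 (topC (- x))).
by rewrite addr0 rmorphN.
Qed.
Let topL : top 1 2%:R L.
Proof.
have := topD (topM (topC 2%:R) topV) (topW 0 (topC (- (e + f)))).
by rewrite addr0 mulr1 rmorphN polyC_natr.
Qed.
Let topA2 : top 2 1 A2.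
Proof. by have := topM (topVc e) (topVc f); rewrite mulr1. Qed.
Let topA : top 3 1 (J10_A e f m).
Proof. by have := topM topV topA2; rewrite mulr1. Qed.
Let topB : top 3 (c * 2%:R) (J10_B e f c m).
Proof. by have := topM (topM (topC c) (topXn 2 topV)) topL;
  rewrite expr1n mulr1. Qed.
Let topG : top 3 (c ^+ 2) (J10_G c m).
Proof. by have := topM (topXn 2 (topC c)) (topXn 3 topV);
  rewrite expr1n mulr1. Qed.

Let topQ : top 4 (16%:R * c ^+ 2 * d ^+ 2) Q.
Proof.
rewrite /Q; have t1 := topM (topXn 2 (topC d)) (topXn 2 topA2).
have t2 := topW 0 (topM (topC (4%:R * c)) (topXn 3 topL)).
have t3 := topW 0 (topM (topM (topC (18%:R * c)) topA2) topL).
have t4 := topW 3 (topC (27%:R * c ^+ 2)).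
have := topM (topC (16%:R * c ^+ 2)) (topD (topD (topD t1 (topN t2)) t3)
  (topN t4)).
by rewrite expr1n mulr1 oppr0 !addr0 !(polyCM, polyC_exp, polyC_natr).
Qed.

Let sQ : size Q = 5%N.
Proof.
have [sQ Q4] := topQ; apply/eqP; rewrite eqn_leq sQ ltnNge.
apply/negP => /(nth_default 0); rewrite Q4 => /eqP.
by apply/negP; rewrite !mulf_neq0 ?expf_neq0 ?subr_eq0 // natr_neq0.
Qed.


Let Qm0 : Q.[m] != 0.
Proof.
rewrite /Q /A2 /L /V !polyE subrr mulf_neq0 //.
  by rewrite mulf_neq0 ?expf_neq0 // natr_neq0.
by move: Qm; congr (_ != 0); rewrite /d; ring.
Qed.

(** At a singular point the derivative along the base gives c = - l T / 2. Then the equation gives T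
    = d^2 / 4 and its derivative in T gives T = d^2 / 6, impossible since d and T are nonzero. *)
Let smooth v : v != m -> smooth_at (J10_A e f m) (J10_B e f c m) (J10_G c m) v.
Proof.
rewrite -subr_eq0 => v0 x; rewrite /J10_A /J10_B /J10_G -/V !derE /= !polyE.
set w := v - m in v0 *; pose T := x / w.
have xE : x = w * T by rewrite /T mulrC divfK.
rewrite xE => E1 E2 E3.
pose a2 := (w - e) * (w - f); pose l := 2%:R * w - (e + f).
(* F1, F2, F3: the equation and its partial derivatives in the coordinate
   T = x / (u - m). *)
have F1 : T ^+ 3 + a2 * T ^+ 2 + c * l * T + c ^+ 2 = 0.
  apply: (mulfI (expf_neq0 3 v0)); rewrite mulr0 -E1 /a2 /l; ring.
have F2 : 3%:R * T ^+ 2 + 2%:R * a2 * T + c * l = 0.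
  apply: (mulfI (expf_neq0 2 v0)); rewrite mulr0 -E2 /a2 /l; ring.
have T0 : T != 0.
  apply/eqP => T0; move/eqP: F1; rewrite T0; apply/negP.
  by rewrite (_ : _ + _ = c ^+ 2) ?expf_neq0 //; ring.
have F3 : l * T + 2%:R * c = 0.
  apply: (mulfI T0); apply: (mulfI (expf_neq0 3 v0)); rewrite !mulr0.
  move: F1; set P1 := (X in X = 0 -> _) => F1.
  move: F2; set P2 := (X in X = 0 -> _) => F2.
  move: E3; set P3 := (X in X = 0 -> _) => E3.
  rewrite (_ : _ * _ = P3 - w ^+ 2 * (3%:R * P1 - T * P2)).
    by rewrite F1 F2 E3; ring.
  by rewrite /P1 /P2 /P3 /l /a2; ring.
have n2 := natr_neq0 C 1.
have cE : c = - (l * T) / 2%:R.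
  apply: (mulIf n2); rewrite divfK //; apply/eqP; rewrite -subr_eq0 opprK -F3.
  by apply/eqP; ring.
have d0 : d != 0 by rewrite subr_eq0.
have n4 := natr_neq0 C 3.
have G1 : T = d ^+ 2 / 4%:R.
  apply: (mulfI (expf_neq0 2 T0)); apply/eqP; rewrite -subr_eq0 -F1.
  by apply/eqP; rewrite cE /d /l /a2; field; rewrite ?n2 ?n4.
have : T * (3%:R * T - d ^+ 2 / 2%:R) = 0.
  by rewrite -F2 cE /d /l /a2; field; rewrite ?n2 ?n4.
move/eqP; rewrite mulf_eq0 (negPf T0) /= {1}G1.
rewrite (_ : _ - _ = d ^+ 2 / 4%:R); last by field; rewrite ?n2 ?n4.
by rewrite mulf_eq0 invr_eq0 (negPf n4) expf_eq0 (negPf d0).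
Qed.

Let c4E : inv_c4 J10 = V ^+ 2 * (16%:R * (A2 ^+ 2 - 3%:R * c%:P * L)).
Proof. by rewrite c4_wcubic /J10_A /J10_B -/V /A2 /L; ring. Qed.

Let c6E : inv_c6 J10 = V ^+ 3 * (- 32%:R * (2%:R * A2 ^+ 3
  - 9%:R * A2 * c%:P * L + 27%:R * c%:P ^+ 2)).
Proof. by rewrite c6_wcubic /J10_A /J10_B /J10_G -/V /A2 /L; ring. Qed.

Let fibm : has_fibre J10 (Some m) (KIs 0).
Proof.
have eD : ord_eq (Some m) (inv_disc J10) 6 by apply: ord_eq_finite discE Qm0.
have g4 := ord_ge_finite c4E; have g6 := ord_ge_finite c6E.
exists 0; split; try exact: ord_ge_finite0; first exact: minimal_finite eD.
by rewrite g4 g6.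
Qed.

Let fiboo : has_fibre J10 None (KIs 8).
Proof.
have eD : ord_eq None (inv_disc J10) (- 10%:Z).
  have t := topM (topXn 6 topV) topQ.
  rewrite discE; apply: ord_eq_infinite t _.
  by rewrite expr1n mul1r !mulf_neq0 ?expf_neq0 ?subr_eq0 // natr_neq0.
have e4 : ord_eq None (inv_c4 J10) (- 6%:Z).
  have t := topM (topC 16%:R) (topD (topXn 2 topA) (topN (topW 2 (topM
    (topC 3%:R) topB)))).
  rewrite c4_wcubic -!(polyC_natr _ 16) -(polyC_natr _ 3);
    apply: ord_eq_infinite t _.
  by rewrite expr1n oppr0 addr0 mulr1 natr_neq0.
have e6 : ord_eq None (inv_c6 J10) (- 9%:Z).
  have t := topM (topC (- 32%:R)) (topD (topD (topM (topC 2%:R) (topXn 3 topA))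
    (topN (topW 2 (topM (topM (topC 9%:R) topA) topB))))
    (topW 5 (topM (topC 27%:R) topG))).
  rewrite c6_wcubic -!(polyC_natr _ 32) -(polyC_natr _ 2) -(polyC_natr _ 9)
    -(polyC_natr _ 27).
  rewrite -polyCN; apply: ord_eq_infinite t _.
  by rewrite expr1n oppr0 !addr0 mulr1 mulf_neq0 ?oppr_eq0 ?natr_neq0.
(* On a K3 surface c4, c6 and the discriminant have degrees at most 8, 12 and 24, whence k = -2. The
   degrees 6, 9, 10 leave the minimal orders 2, 3, 14. *)
exists (- 2%:Z); cbv beta zeta.
by rewrite !(ord_eq_ge _ e4) !(ord_eq_ge _ e6) e4 e6 eD.
Qed.

Lemma J10_singular_fibres_collision :
  exists2 l, collision J10_fibres l & singular_fibres J10 l.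
Proof. exact: (singular_fibres_quartic_collision discE sQ Qm0). Qed.

(** A cusp has c l = 3 T^2 and c^2 = - T^3. With l^2 - 4 (w - e) (w - f) = d^2 this yields c^2 d^2 =
    -3 T^4, hence c^6 d^6 = -27 T^12 = -27 c^8. *)
Lemma J10_singular_fibres : d ^+ 6 + 27%:R * c ^+ 2 != 0 ->
  singular_fibres J10 J10_fibres.
Proof.
move=> nc; apply: (singular_fibres_quartic discE sQ Qm0) => // v.
rewrite -subr_eq0 => v0; rewrite c4E c6E /A2 /L /V !polyE.
set w := v - m in v0 *.
move=> /eqP; rewrite mulf_eq0 expf_eq0 (negPf v0) andbF mulf_eq0.
rewrite (negPf (natr_neq0 C 15)) => /eqP E4 /eqP.
rewrite mulf_eq0 expf_eq0 (negPf v0) andbF mulf_eq0 oppr_eq0.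
rewrite (negPf (natr_neq0 C 31)) => /eqP.
move: E4; pose T := - ((w - e) * (w - f)) / 3%:R; pose l := 2%:R * w - (e + f).
have n3 := natr_neq0 C 2; have n27 := natr_neq0 C 26.
have aE : (w - e) * (w - f) = - (3%:R * T) by rewrite /T; field.
rewrite -/l aE => E4 E6.
have lE : c * l = 3%:R * T ^+ 2.
  by apply: (mulfI n3); apply/eqP; rewrite eq_sym -subr_eq0 -E4; apply/eqP;
    ring.
have cE : c ^+ 2 = - T ^+ 3.
  apply: (mulfI n27); apply/eqP; rewrite -subr_eq0 -E6.
  by rewrite -[_ * c * l]mulrA lE; apply/eqP; ring.
have dE : c ^+ 2 * d ^+ 2 = - 3%:R * T ^+ 4.
  have -> : d ^+ 2 = l ^+ 2 - 4%:R * ((w - e) * (w - f)) by rewrite /d /l; ring.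
  by rewrite mulrBr -exprMn lE aE cE; ring.
move/eqP: nc; apply; apply: (mulfI (expf_neq0 6 c0)); rewrite mulr0 mulrDr.
have -> : c ^+ 6 * d ^+ 6 = (c ^+ 2 * d ^+ 2) ^+ 3 by ring.
have -> : c ^+ 6 * (27%:R * c ^+ 2) = 27%:R * (c ^+ 2) ^+ 4 by ring.
by rewrite dE cE; ring.
Qed.
End J10.

(** * Singular fibres of f_11 *)

Definition J11_A (C : fieldType) (a b : C) : {poly C} := 'X * (b%:P
  - ((a - 1) * (b - 1) + (a * b + 1))%:P * 'X + a%:P * 'X ^+ 2).
Definition J11_B (C : fieldType) (a b : C) : {poly C} :=
  ((a - 1) * (b - 1))%:P * 'X ^+ 3 * ((a * b + 1)%:P * 'X - (2%:R * b)%:P).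
Definition J11_G (C : fieldType) (a b : C) : {poly C} :=
  (b * ((a - 1) * (b - 1)) ^+ 2)%:P * 'X ^+ 5.

Section J11.
Variable C : numClosedFieldType.
Variables a b : C.
Hypotheses (a0 : a != 0) (a1 : a != 1) (b0 : b != 0) (b1 : b != 1).
Hypotheses (ab : a != b) (ab1 : a * b != 1).
Let p := (a - 1) * (b - 1).
Let n := a * b + 1.
Let s := p + n.
Let A1 : {poly C} := b%:P - s%:P * 'X + a%:P * 'X ^+ 2.
Let L : {poly C} := n%:P * 'X - (2%:R * b)%:P.

Let J11 := wcubic (J11_A a b) (J11_B a b) (J11_G a b).

Let al : {poly C} := a%:P * 'X - s%:P.
(** The discriminant is visibly divisible by u^8 only. Two more factors u come out through L^2 - 4 b
    A1 = (a b - 1)^2 u^2 + 4 b p u and A1 = b + u al, which is why [al] occurs. *)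
Let Q := (16%:R * p ^+ 2)%:P * (
  ((a * b - 1) ^+ 2)%:P * A1 ^+ 2
  + p%:P * ((4%:R * b)%:P * 'X * al ^+ 2 + (24%:R * b * n ^+ 2)%:P * 'X
            + (18%:R * b * n)%:P * 'X * al
            - (28%:R * b ^+ 2)%:P * al - (30%:R * b ^+ 2 * n)%:P
            - (4%:R * n ^+ 3)%:P * 'X ^+ 2)
  - (27%:R * b ^+ 2 * p ^+ 2)%:P).

Let p0 : p != 0. Proof. by rewrite mulf_neq0 ?subr_eq0. Qed.

Let discE : inv_disc J11 = ('X - 0%:P) ^+ 10 * Q.
Proof.
rewrite subr0 disc_wcubic /J11_A /J11_B /J11_G /Q /A1 /al /s /n /p.
by rewrite !(polyCM, polyCB, polyCD, polyC_exp, polyC_natr, polyC1); ring.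
Qed.

Let topA1 : top 2 a A1.
Proof.
have := topD (topD (topW 1 (topC b)) (topN (topW 0 (topM (topC s) (topX C)))))
  (topM (topC a) (topXn 2 (topX C))).
by rewrite oppr0 !add0r expr1n mulr1.
Qed.
Let topal : top 1 a al.
Proof.
by have := topD (topM (topC a) (topX C)) (topN (topW 0 (topC s)));
  rewrite oppr0 addr0 mulr1.
Qed.
Let topL : top 1 n L.
Proof.
by have := topD (topM (topC n) (topX C)) (topN (topW 0 (topC (2%:R * b))));
  rewrite oppr0 addr0 mulr1.
Qed.
Let topA : top 3 a (J11_A a b).
Proof. by have := topM (topX C) topA1; rewrite mul1r. Qed.
Let topB : top 4 (p * n) (J11_B a b).
Proof. by have := topM (topM (topC p) (topXn 3 (topX C))) topL;
  rewrite expr1n mulr1. Qed.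
Let topG : top 5 (b * p ^+ 2) (J11_G a b).
Proof. by have := topM (topC (b * p ^+ 2)) (topXn 5 (topX C));
  rewrite expr1n mulr1. Qed.

Let topQ : top 4 (16%:R * p ^+ 2 * ((a * b - 1) ^+ 2 * a ^+ 2)) Q.
Proof.
have t1 := topM (topC ((a * b - 1) ^+ 2)) (topXn 2 topA1).
have u1 := topM (topM (topC (4%:R * b)) (topX C)) (topXn 2 topal).
have u2 := topW 1 (topM (topC (24%:R * b * n ^+ 2)) (topX C)).
have u3 := topW 0 (topM (topM (topC (18%:R * b * n)) (topX C)) topal).
have u4 := topW 1 (topM (topC (28%:R * b ^+ 2)) topal).
have u5 := topW 2 (topC (30%:R * b ^+ 2 * n)).
have u6 := topW 0 (topM (topC (4%:R * n ^+ 3)) (topXn 2 (topX C))).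
have u := topD (topD (topD (topD (topD u1 u2) u3) (topN u4)) (topN u5))
  (topN u6).
have t2 := topW 0 (topM (topC p) u).
have t3 := topW 3 (topC (27%:R * b ^+ 2 * p ^+ 2)).
have := topM (topC (16%:R * p ^+ 2)) (topD (topD t1 t2) (topN t3)).
by rewrite oppr0 !addr0.
Qed.

Let lc0 : 16%:R * p ^+ 2 * ((a * b - 1) ^+ 2 * a ^+ 2) != 0.
Proof. by rewrite !mulf_neq0 ?expf_neq0 ?subr_eq0 // natr_neq0. Qed.

Let sQ : size Q = 5%N.
Proof.
have [sQ Q4] := topQ; apply/eqP; rewrite eqn_leq sQ ltnNge.
by apply/negP => /(nth_default 0); rewrite Q4 => /eqP; apply/negP.
Qed.

(** Here a != b keeps the fibre at u = 0 an I_4^*, just as a b != 1 does at infinity through the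
    leading coefficient of [Q]. *)
Let Q0 : Q.[0] != 0.
Proof.
have -> : Q.[0] = 16%:R * p ^+ 2 * (b ^+ 2 * (a - b) ^+ 2).
  by rewrite /Q /A1 /al !polyE /s /n /p; ring.
by rewrite !mulf_neq0 ?expf_neq0 ?subr_eq0 // natr_neq0.
Qed.

(** At T = 0 and T = p the equation reduces to b p^2 and a v^2 p^2, both nonzero. Elsewhere a
    combination of the three equations is v T (T - p)^2, which cannot vanish. *)
Let smooth v : v != 0 -> smooth_at (J11_A a b) (J11_B a b) (J11_G a b) v.
Proof.
move=> v0 x; rewrite /J11_A /J11_B /J11_G !derE /= !polyE.
rewrite -/p -/n -/s; pose T := x / v ^+ 2.
have v20 : v ^+ 2 != 0 by rewrite expf_neq0.
have xE : x = v ^+ 2 * T by rewrite /T mulrC divfK.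
rewrite xE => E1 E2 E3.
(* The equation and its partial derivatives in the coordinate T = x / u^2. *)
pose h := v * T * (T - p) * (T - n) + b * (T - p) ^+ 2 + a * v ^+ 2 * T ^+ 2.
pose hT := v * ((T - p) * (T - n) + T * (T - n) + T * (T - p))
  + 2%:R * b * (T - p) + 2%:R * a * v ^+ 2 * T.
pose hU := T * (T - p) * (T - n) + 2%:R * a * v * T ^+ 2.
have F1 : h = 0.
  by apply: (mulfI (expf_neq0 5 v0)); rewrite mulr0 -E1 /h /s; ring.
have F2 : hT = 0.
  by apply: (mulfI (expf_neq0 3 v0)); rewrite mulr0 -E2 /hT /s; ring.
have F3 : hU = 0.
  apply: (mulfI (expf_neq0 6 v0)); rewrite mulr0.
  move: E3; set P3 := (X in X = 0 -> _) => E3.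
  rewrite (_ : _ * _ = v * P3 - 5%:R * v ^+ 5 * h + 2%:R * T * v ^+ 5 * hT).
    by rewrite F1 F2 E3; ring.
  by rewrite /P3 /h /hT /hU /s; ring.
have T0 : T != 0.
  apply/eqP => T0; move/eqP: F1; rewrite /h T0; apply/negP.
  by rewrite (_ : _ + _ = b * p ^+ 2); [by rewrite mulf_neq0 ?expf_neq0 | ring].
have Tp : T - p != 0.
  apply/eqP => Tp; move/eqP: F1; rewrite /h Tp; apply/negP.
  rewrite (_ : _ + _ = a * v ^+ 2 * T ^+ 2); last by ring.
  by rewrite mulf_neq0 ?expf_neq0 // mulf_neq0.
have F4 : (T - p) * (T - n) = - 2%:R * a * v * T.
  by apply: (mulfI T0); apply/eqP; rewrite -subr_eq0 -F3 /hU; apply/eqP; ring.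
have F5 : b * (T - p) ^+ 2 = a * v ^+ 2 * T ^+ 2.
  apply/eqP; rewrite -subr_eq0; apply/eqP.
  rewrite (_ : _ - _ = h - v * hU); first by rewrite F1 F3; ring.
  by rewrite /h /hU; ring.
have : v * T * (T - p) ^+ 2 = 0.
  rewrite (_ : _ * _ = (T - p) * hT
    - (v * (T - p) + v * T) * ((T - p) * (T - n) + 2%:R * a * v * T)
    - 2%:R * (b * (T - p) ^+ 2 - a * v ^+ 2 * T ^+ 2)).
    by rewrite F2 F4 F5; ring.
  by rewrite /hT; ring.
by apply/eqP; rewrite mulf_neq0 ?expf_neq0 // mulf_neq0.
Qed.

Let c4E : inv_c4 J11 = 'X ^+ 2 * (16%:R * (A1 ^+ 2 - 3%:R * p%:P * 'X * L)).
Proof. by rewrite c4_wcubic /J11_A /J11_B -/p -/n -/s /A1 /L; ring. Qed.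

Let c6E : inv_c6 J11 = 'X ^+ 3 * (- 32%:R * (2%:R * A1 ^+ 3
  - 9%:R * A1 * 'X * p%:P * L + 27%:R * (b * p ^+ 2)%:P * 'X ^+ 2)).
Proof. by rewrite c6_wcubic /J11_A /J11_B /J11_G -/p -/n -/s /A1 /L; ring. Qed.


Let fib0 : has_fibre J11 (Some 0) (KIs 4).
Proof.
have eD : ord_eq (Some 0) (inv_disc J11) 10 by apply: ord_eq_finite discE Q0.
have e4 : ord_eq (Some 0) (inv_c4 J11) 2.
  apply: ord_eq_finite; first by rewrite subr0; exact: c4E.
  rewrite /A1 /L !polyE !(mulr0, mul0r, expr0n) /=
    !(mulr0, subr0, addr0, mul0r).
  by rewrite mulf_neq0 ?expf_neq0 ?natr_neq0.
have e6 : ord_eq (Some 0) (inv_c6 J11) 3.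
  apply: ord_eq_finite; first by rewrite subr0; exact: c6E.
  rewrite /A1 /L !polyE (_ : _ * _ = - 64%:R * b ^+ 3); last by ring.
  by rewrite mulf_neq0 ?expf_neq0 ?oppr_eq0 ?natr_neq0.
exists 0; split; try exact: ord_ge_finite0; first exact: minimal_finite eD.
by rewrite e4 e6.
Qed.

Let fiboo : has_fibre J11 None (KIs 4).
Proof.
have eD : ord_eq None (inv_disc J11) (- 14%:Z).
  have t := topM (topXn 10 (topX C)) topQ.
  by rewrite discE subr0; apply: ord_eq_infinite t _; rewrite expr1n mul1r.
have e4 : ord_eq None (inv_c4 J11) (- 6%:Z).
  have t := topM (topC 16%:R) (topD (topXn 2 topA) (topN (topW 1 (topM
    (topC 3%:R) topB)))).
  rewrite c4_wcubic -!(polyC_natr _ 16) -(polyC_natr _ 3);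
    apply: ord_eq_infinite t _.
  by rewrite oppr0 addr0 mulf_neq0 ?expf_neq0 ?natr_neq0.
have e6 : ord_eq None (inv_c6 J11) (- 9%:Z).
  have t := topM (topC (- 32%:R)) (topD (topD (topM (topC 2%:R) (topXn 3 topA))
    (topN (topW 1 (topM (topM (topC 9%:R) topA) topB))))
    (topW 3 (topM (topC 27%:R) topG))).
  rewrite c6_wcubic -!(polyC_natr _ 32) -(polyC_natr _ 2) -(polyC_natr _ 9)
    -(polyC_natr _ 27).
  rewrite -polyCN; apply: ord_eq_infinite t _.
  by rewrite oppr0 !addr0 !mulf_neq0 ?expf_neq0 ?oppr_eq0 ?natr_neq0.
exists (- 2%:Z); cbv beta zeta.
by rewrite !(ord_eq_ge _ e4) !(ord_eq_ge _ e6) e4 e6 eD.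
Qed.

Lemma J11_singular_fibres_collision :
  exists2 l, collision J11_fibres l & singular_fibres J11 l.
Proof. exact: (singular_fibres_quartic_collision discE sQ Q0). Qed.

Lemma J11_singular_fibres :
    ((a - 1) * (b - 1) * (a * b + 1) - (a * b - 1) ^+ 2) ^+ 3
      - 27%:R * ((a - 1) * (b - 1)) ^+ 2 * (a * b) ^+ 2 != 0 ->
  singular_fibres J11 J11_fibres.
Proof.
move=> nc; apply: (singular_fibres_quartic discE sQ Q0) => // v v0.
rewrite c4E c6E /A1 /L !polyE => /eqP.
rewrite mulf_eq0 expf_eq0 (negPf v0) andbF mulf_eq0.
rewrite (negPf (natr_neq0 C 15)) => /eqP E4 /eqP.
rewrite mulf_eq0 expf_eq0 (negPf v0) andbF mulf_eq0 oppr_eq0.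
rewrite (negPf (natr_neq0 C 31)) => /eqP.
have n3 := natr_neq0 C 2; have n27 := natr_neq0 C 26.
(* The cubic has the triple root x = v^2 T. *)
pose T := - (b - s * v + a * v ^+ 2) / (3%:R * v).
have aE : b - s * v + a * v ^+ 2 = - (3%:R * v * T).
  by rewrite /T; field; rewrite ?v0 ?n3.
move: E4; rewrite aE => E4 E6.
have lE : p * (n * v - 2%:R * b) = 3%:R * v * T ^+ 2.
  apply: (mulfI n3); apply: (mulfI v0).
  by apply/eqP; rewrite eq_sym -subr_eq0 -E4; apply/eqP; ring.
have gE : b * p ^+ 2 = - (v * T ^+ 3).
  apply: (mulfI n27); apply: (mulfI (expf_neq0 2 v0)); apply/eqP;
    rewrite -subr_eq0 -E6.
  have -> : 9%:R * - (3%:R * v * T) * v * p * (n * v - 2%:R * b)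
    = 9%:R * - (3%:R * v * T) * v * (p * (n * v - 2%:R * b)) by ring.
  by rewrite lE; apply/eqP; ring.
have pE : a * v * p ^+ 2 = (p - T) ^+ 3.
  apply: (mulfI v0).
  have -> : v * (a * v * p ^+ 2) = p ^+ 2 * (b - s * v + a * v ^+ 2)
    + s * v * p ^+ 2 - b * p ^+ 2 by ring.
  rewrite aE gE; apply/eqP; rewrite -subr_eq0; apply/eqP.
  have : p * (p * (n * v - 2%:R * b)) = p ^+ 2 * n * v - 2%:R *
    (b * p ^+ 2) by ring.
  rewrite lE gE => /eqP; rewrite -subr_eq0 => /eqP E.
  move: E; set P := (X in X = 0 -> _) => E.
  by rewrite (_ : _ - _ = - P); [rewrite E oppr0 | rewrite /P /s; ring].
(* Multiplying [gE] and [pE] cancels v and gives H^3 = - a b p^4. [etaE] expresses the other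
   ingredient of the condition through H^2, so that comparing sixth powers of H eliminates T as
   well. *)
pose H := T * (p - T).
have HE : H ^+ 3 = - (a * b) * p ^+ 4.
  apply: (mulfI v0).
  have -> : v * H ^+ 3 = (v * T ^+ 3) * (p - T) ^+ 3 by rewrite /H; ring.
  by rewrite -pE -[v * T ^+ 3]opprK -gE; ring.
have NE : p ^+ 2 * n = 3%:R * p * T ^+ 2 - 2%:R * T ^+ 3.
  apply: (mulfI v0).
  have -> : v * (p ^+ 2 * n) = p * (p * (n * v - 2%:R * b)) + 2%:R *
    (b * p ^+ 2) by ring.
  by rewrite lE gE; ring.
have etaE : (p * n - (a * b - 1) ^+ 2) * p ^+ 2 = 3%:R * H ^+ 2.
  apply: (mulIf (expf_neq0 2 p0)).
  have -> : (p * n - (a * b - 1) ^+ 2) * p ^+ 2 * p ^+ 2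
     = p ^+ 3 * (p ^+ 2 * n) - (p ^+ 2 * n) ^+ 2 - 4%:R * (-
       (a * b) * p ^+ 4) by rewrite /n; ring.
  by rewrite -HE NE /H; ring.
move/eqP: nc; apply; rewrite -/p -/n; apply: (mulIf (expf_neq0 6 p0));
  rewrite mul0r.
have -> : ((p * n - (a * b - 1) ^+ 2) ^+ 3 - 27%:R * p ^+ 2 *
  (a * b) ^+ 2) * p ^+ 6
   = ((p * n - (a * b - 1) ^+ 2) * p ^+ 2) ^+ 3 - 27%:R * (-
     (a * b) * p ^+ 4) ^+ 2 by ring.
by rewrite etaE -HE; ring.
Qed.
End J11.

(** * Singular fibres of f_8 *)

Section TwoTorsion.
Variables (C : numClosedFieldType) (A B : {poly C}) (v : C).
Let f := wcubic A B 0.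

(** For x (x^2 + A x + B) the discriminant is 16 B^2 (A^2 - 4 B): a simple root of B gives an I_2, a
    simple root of A^2 - 4 B an I_1, and a common root a III. *)
Lemma has_fibre_I2 q : B = ('X - v%:P) * q -> q.[v] != 0 -> A.[v] != 0 ->
  has_fibre f (Some v) (KI 2).
Proof.
move=> BE qv Av.
apply: (@has_fibre_I _ v f 1 (16%:R * q ^+ 2 * (A ^+ 2 - 4%:R * B))).
- rewrite c4_wcubic BE !polyE subrr mul0r mulr0 subr0.
  by rewrite mulf_neq0 ?expf_neq0 ?natr_neq0.
- by rewrite disc_wcubic BE; ring.
- rewrite BE !polyE subrr mul0r mulr0 subr0.
  by rewrite !mulf_neq0 ?expf_neq0 ?natr_neq0.
Qed.

Lemma has_fibre_III q : B = ('X - v%:P) * q -> q.[v] != 0 -> A.[v] = 0 ->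
  has_fibre f (Some v) KIII.
Proof.
move=> BE qv Av; have [r [AE _]] := factor_root Av.
have eD : ord_eq (Some v) (inv_disc f) 3.
  apply: (@ord_eq_finite _ v 3 _ (16%:R * q ^+ 2 * (('X - v%:P) * r ^+ 2
    - 4%:R * q))).
    by rewrite disc_wcubic AE BE; ring.
  rewrite !polyE subrr mul0r sub0r.
  by rewrite !mulf_neq0 ?expf_neq0 ?oppr_eq0 ?mulf_neq0 ?natr_neq0.
have e4 : ord_eq (Some v) (inv_c4 f) 1.
  apply: (@ord_eq_finite _ v 1 _ (16%:R * (('X - v%:P) * r ^+ 2 - 3%:R * q))).
    by rewrite c4_wcubic AE BE; ring.
  rewrite !polyE subrr mul0r sub0r.
  by rewrite !mulf_neq0 ?oppr_eq0 ?mulf_neq0 ?natr_neq0.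
have g6 : ord_ge (Some v) (inv_c6 f) 2.
  apply: (@ord_ge_finite _ v 2 _ (- 32%:R * r * (2%:R * ('X - v%:P) * r ^+ 2
    - 9%:R * q))).
  by rewrite c6_wcubic AE BE; ring.
exists 0; split; try exact: ord_ge_finite0; first exact: minimal_finite eD.
by rewrite e4 g6 eD.
Qed.

Lemma has_fibre_I1 q : A ^+ 2 - 4%:R * B = ('X - v%:P) * q -> q.[v] != 0 ->
  B.[v] != 0 -> has_fibre f (Some v) (KI 1).
Proof.
move=> DE qv Bv; have AE : A ^+ 2 = 4%:R * B + ('X - v%:P) * q.
  by rewrite -DE; ring.
apply: (@has_fibre_I _ v f 0 (16%:R * B ^+ 2 * q)).
- rewrite c4_wcubic AE !polyE subrr mul0r addr0 -mulrBl.
  rewrite (_ : 4%:R - 3%:R = 1) ?mul1r; last by ring.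
  by rewrite mulf_neq0 ?natr_neq0.
- rewrite disc_wcubic (_ : _ - _ = B ^+ 2 * (A ^+ 2 - 4%:R * B)); last by ring.
  by rewrite DE; ring.
- by rewrite !polyE !mulf_neq0 ?expf_neq0 ?natr_neq0.
Qed.
End TwoTorsion.

Definition J8_A (C : fieldType) (a b : C) : {poly C} :=
  'X * (2%:R - ((a - 1) * (b - 1) + a * b + 1)%:P * 'X).
Definition J8_B (C : fieldType) (a b : C) : {poly C} :=
  'X ^+ 2 * ((1 - ((a - 1) * (b - 1))%:P * 'X)
  * (1 - 'X) * (1 - (a * b)%:P * 'X)).

Section J8.
Variable C : numClosedFieldType.
Variables a b : C.
Hypotheses (a0 : a != 0) (a1 : a != 1) (b0 : b != 0) (b1 : b != 1).
Hypotheses (ab : a != b) (ab1 : a * b != 1) (p1 : (a - 1) * (b - 1) != 1)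
  (pq : (a - 1) * (b - 1) != a * b).
Let p := (a - 1) * (b - 1).
Let q := a * b.
Let s := p + q + 1.

Let J8 := wcubic (J8_A a b) (J8_B a b) 0.

Let p0 : p != 0. Proof. by rewrite mulf_neq0 ?subr_eq0. Qed.
Let q0 : q != 0. Proof. by rewrite mulf_neq0. Qed.
(** The only nonzero root of A^2 - 4 B. The numerator comes from (p + q + 1)^2 - 4 (p + q + p q) =
    (a - b)^2. *)
Let u0 := - (a - b) ^+ 2 / (4%:R * p * q).

Let n4 := natr_neq0 C 3.
Let pq4 : 4%:R * p * q != 0.
Proof. exact: mulf_neq0 (mulf_neq0 n4 p0) q0. Qed.
Let u00 : u0 != 0.
Proof.
by rewrite mulf_eq0 oppr_eq0 sqrf_eq0 subr_eq0 (negPf ab) invr_eq0 (negPf pq4).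
Qed.

Let betaE : (J8_A a b) ^+ 2 - 4%:R * (J8_B a b) = ('X - u0%:P) *
  ((4%:R * p * q)%:P * 'X ^+ 4).
Proof.
have -> : ('X - u0%:P) * ((4%:R * p * q)%:P * 'X ^+ 4)
   = 'X ^+ 4 * ((4%:R * p * q)%:P * 'X - (u0 * (4%:R * p * q))%:P).
  by rewrite (polyCM u0); ring.
rewrite /u0 divfK // /J8_A /J8_B -/p -/q.
by rewrite /p /q !(polyCN, polyCM, polyCB, polyCD, polyC_exp, polyC_natr,
  polyC1); ring.
Qed.

Let discE : inv_disc J8 = 16%:R * (J8_B a b) ^+ 2 * ((J8_A a b) ^+ 2 - 4%:R *
  (J8_B a b)).
Proof. by rewrite disc_wcubic; ring. Qed.

Let rts := [:: 1; p^-1; q^-1].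

Let Broot v : ((J8_B a b).[v] == 0) = (v == 0) || (v \in rts).
Proof.
rewrite /J8_B -/p -/q !polyE mulf_eq0 expf_eq0 !mulf_eq0 /= !inE !subr_eq0.
have inv x : x != 0 -> (1 == x * v) = (v == x^-1).
  move=> x0; apply/eqP/eqP => [E|->]; last by rewrite divff.
  by apply: (mulfI x0); rewrite -E divff.
by rewrite !inv // [1 == v]eq_sym; case: (v == 1); rewrite ?orbT ?orbF // orbA.
Qed.

Let disc0 v : ((inv_disc J8).[v] == 0) = [|| v == 0, v \in rts | v == u0].
Proof.
rewrite discE betaE; move: (J8_B a b) (Broot v) => B BE.
have -> : (16%:R * B ^+ 2 * (('X - u0%:P) * ((4%:R * p * q)%:P * 'X ^+ 4))).[v]
    = 16%:R * (4%:R * p * q) * (B.[v] ^+ 2 * ((v - u0) * v ^+ 4)).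
  by rewrite !polyE; ring.
rewrite mulf_eq0 (negPf (mulf_neq0 (natr_neq0 C 15) pq4)) /=.
rewrite mulf_eq0 sqrf_eq0 BE mulf_eq0 subr_eq0 expf_eq0 /=.
by case: (v == 0); rewrite ?orbT ?orbF.
Qed.

Let rts_neq0 v : v \in rts -> v != 0.
Proof.
by rewrite !inE => /or3P[] /eqP->; rewrite ?oner_neq0 ?invr_eq0.
Qed.

Let uniq_rts : uniq rts.
Proof.
have inv1 x : (1 == x^-1) = (x == 1) by rewrite eq_sym invr_eq1.
rewrite /= !inE !inv1 negb_or p1 ab1 /= andbT.
by apply: contra_neq pq => /invr_inj.
Qed.

Let Bfactor v : v \in rts ->
  exists2 r, (J8_B a b) = ('X - v%:P) * r & r.[v] != 0.
Proof.
move=> vr; pose P : {poly C} := \prod_(z <- rem v rts) ('X - z%:P).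
have BE : (J8_B a b) = (- (p * q))%:P * 'X ^+ 2 * \prod_(z <- rts) ('X - z%:P).
  have inv x : x != 0 -> 1 - x%:P * 'X = - (x%:P * ('X - x^-1%:P)) :> {poly C}.
    by move=> x0; rewrite mulrBr -polyCM divff // polyC1; ring.
  rewrite /J8_B -/p -/q (inv p) // (inv q) // /rts !big_cons big_nil.
  by rewrite polyCN (polyCM p) polyC1; ring.
exists ((- (p * q))%:P * 'X ^+ 2 * P).
  by rewrite BE (perm_big _ (perm_to_rem vr)) big_cons mulrCA.
have : ~~ root P v by rewrite root_prod_XsubC mem_rem_uniq // !inE eqxx.
rewrite rootE; move: P => P Pv; rewrite !polyE.
apply: mulf_neq0 Pv; apply: mulf_neq0 (expf_neq0 2 (rts_neq0 vr)).
by rewrite oppr_eq0; apply: mulf_neq0.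
Qed.

Let disc_neq0 : inv_disc J8 != 0.
Proof.
apply/eqP => D0; pose r := [:: 0, u0 & rts].
pose P : {poly C} := \prod_(z <- r) ('X - z%:P).
have : P.[0] == 0 by rewrite -rootE root_prod_XsubC mem_head.
have [x] := @closed_nonrootP _ P (monic_neq0 (monic_prod_XsubC _ _ _)).
rewrite root_prod_XsubC => xr _.
have := disc0 x; rewrite D0 horner0 eqxx => /esym.
by move: xr; rewrite !inE; case: (x == 0); case: (x == u0) => //=;
  rewrite orbF => /negPf ->.
Qed.

Let F v := if v == u0 then KIII else KI 2.

(** Where B vanishes, [betaE] reads A^2 = 4 p q v^4 (v - u0). So a III arises exactly when [u0]
    falls on one of the [rts]. *)
Let Aroot v : v \in rts -> ((J8_A a b).[v] == 0) = (v == u0).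
Proof.
move=> vr; have v0 := rts_neq0 vr; have [r BE _] := Bfactor vr.
have /(congr1 (fun h : {poly C} => h.[v])) := betaE.
rewrite BE; move: (J8_A a b) => A; rewrite !polyE subrr mul0r mulr0 subr0 => AE.
rewrite -sqrf_eq0 AE mulf_eq0 subr_eq0 mulf_eq0 (negPf pq4) expf_eq0.
by rewrite (negPf v0) orbF.
Qed.

Let fib_rts v : v \in rts -> has_fibre J8 (Some v) (F v).
Proof.
move=> vr; have [r BE rv0] := Bfactor vr; rewrite /F; case: eqP => [vu|/eqP vu].
  by apply: (has_fibre_III BE rv0); apply/eqP; rewrite Aroot ?vu -?vu.
by apply: (has_fibre_I2 BE rv0); rewrite Aroot.
Qed.

Let fib_u0 : u0 \notin rts -> has_fibre J8 (Some u0) (KI 1).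
Proof.
move=> ur; apply: (has_fibre_I1 betaE).
  by rewrite !polyE; apply: mulf_neq0 pq4 (expf_neq0 4 u00).
by rewrite Broot negb_or u00.
Qed.

Let fib0 : has_fibre J8 (Some 0) (KIs 2).
Proof.
pose P := (1 - p%:P * 'X) * (1 - 'X) * (1 - q%:P * 'X) : {poly C}.
have BE : (J8_B a b) = 'X ^+ 2 * P by [].
have AE : (J8_A a b) = 'X * (2%:R - s%:P * 'X) by [].
have P0 : P.[0] = 1 by rewrite /P !polyE !mulr0 subr0 !mulr1.
have e4 : ord_eq (Some 0) (inv_c4 J8) 2.
  apply: (@ord_eq_finite _ 0 2 _ (16%:R * ((2%:R - s%:P * 'X) ^+ 2
    - 3%:R * P))).
    by rewrite subr0 c4_wcubic AE BE; ring.
  clear BE; move: P P0 => P P0; rewrite !polyE P0.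
  by rewrite (_ : _ * _ = 16%:R) ?natr_neq0 //; ring.
have e6 : ord_eq (Some 0) (inv_c6 J8) 3.
  apply: (@ord_eq_finite _ 0 3 _ (- 32%:R * (2%:R - s%:P * 'X)
     * (2%:R * (2%:R - s%:P * 'X) ^+ 2 - 9%:R * P))).
    by rewrite subr0 c6_wcubic AE BE; ring.
  clear BE; move: P P0 => P P0; rewrite !polyE P0.
  by rewrite (_ : _ * _ = 64%:R) ?natr_neq0 //; ring.
have eD : ord_eq (Some 0) (inv_disc J8) 8.
  apply: (@ord_eq_finite _ 0 8 _ (16%:R * P ^+ 2 * (('X - u0%:P) *
    (4%:R * p * q)%:P))).
    by rewrite subr0 discE betaE BE; ring.
  clear BE; move: P P0 => P P0; rewrite !polyE P0 expr1n mulr1 sub0r.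
  by apply: mulf_neq0 (natr_neq0 C 15) (mulf_neq0 _ pq4); rewrite oppr_eq0.
exists 0; split; try exact: ord_ge_finite0; first exact: minimal_finite eD.
by rewrite e4 e6.
Qed.

Let fiboo : has_fibre J8 None (KIIIs).
Proof.
have t1c (x : C) : top 1 (- x) (1 - x%:P * 'X).
  have := topD (topW 0 (topC 1)) (topN (topM (topC x) (topX C))).
  by rewrite mulr1 add0r polyC1.
have tA : top 2 (- s) (J8_A a b).
  have := topM (topX C) (topD (topW 0 (topC 2%:R)) (topN (topM (topC s)
    (topX C)))).
  by rewrite mulr1 add0r mul1r polyC_natr.
have tB : top 5 (- (p * q)) (J8_B a b).
  have := topM (topXn 2 (topX C)) (topM (topM (t1c p) (t1c 1)) (t1c q)).
  by rewrite expr1n mul1r polyC1 mul1r mulrN1 opprK mulrN.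
have e4 : ord_eq None (inv_c4 J8) (- 5%:Z).
  have t := topM (topC 16%:R) (topD (topW 0 (topXn 2 tA)) (topN (topM
    (topC 3%:R) tB))).
  rewrite c4_wcubic -!(polyC_natr _ 16) -(polyC_natr _ 3);
    apply: ord_eq_infinite t _.
  rewrite add0r; apply: mulf_neq0 (natr_neq0 C 15) _.
  rewrite oppr_eq0; apply: mulf_neq0 (natr_neq0 C 2) _.
  by rewrite oppr_eq0; apply: mulf_neq0.
(* Only a bound: the coefficient of degree 7 is a multiple of s = p + q + 1, which may vanish, and
   the III^* row of the table asks for no more. *)
have g6 : ord_ge None (inv_c6 J8) (- 7%:Z).
  have t := topM (topC (- 32%:R)) (topD (topW 0 (topM (topC 2%:R) (topXn 3 tA)))
    (topN (topM (topM (topC 9%:R) tA) tB))).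
  rewrite c6_wcubic mulr0 addr0 -!(polyC_natr _ 32) -(polyC_natr _ 2)
    -(polyC_natr _ 9).
  by rewrite -polyCN; apply: ord_ge_infinite t.
have eD : ord_eq None (inv_disc J8) (- 15%:Z).
  have tX : top 1 1 ('X - u0%:P).
    have := topD (topX C) (topN (topW 0 (topC u0))).
    by rewrite oppr0 addr0.
  have t := topM (topM (topC 16%:R) (topXn 2 tB))
    (topM tX (topM (topC (4%:R * p * q)) (topXn 4 (topX C)))).
  rewrite discE betaE -(polyC_natr _ 16); apply: ord_eq_infinite t _.
  rewrite expr1n mul1r mulr1; apply: mulf_neq0 pq4.
  apply: mulf_neq0 (natr_neq0 C 15) _; rewrite sqrf_eq0 oppr_eq0.
  exact: mulf_neq0.
exists (- 2%:Z); cbv beta zeta.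
rewrite !(ord_eq_ge _ e4) e4 eD.
have ge6 k : (k <= - 7%:Z)%R -> ord_ge None (inv_c6 J8) k.
  by move=> k7; apply: ord_ge_trans k7 g6.
by rewrite (ge6 (6 * - 2%:Z + 0%N%:Z)) // (ge6 (6 * - 2%:Z + 5%N%:Z)).
Qed.

(** Covers both cases: [t = rts] with an I_1 at [u0], and [t = rem u0 rts] with a III there. *)
Let fibres_of (t : seq C) k : uniq (rcons t u0) ->
    {subset t <= rts} -> {subset rts <= rcons t u0} ->
    has_fibre J8 (Some u0) k ->
  singular_fibres J8 (KIIIs :: KIs 2 :: rcons (nseq (size t) (KI 2)) k).
Proof.
move=> ut tr rt fibk.
pose G z := if z == u0 then k else KI 2.
have -> : rcons (nseq (size t) (KI 2)) k = map G (rcons t u0).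
  rewrite map_rcons /G eqxx; congr rcons.
  move: ut; rewrite rcons_uniq => /andP[ut _].
  elim: (t) ut => //= x t' IH; rewrite in_cons negb_or eq_sym =>
    /andP[ux /IH ->].
  by rewrite (negPf ux).
apply: (@singular_fibres_intro _ J8 0) => //.
- rewrite mem_rcons in_cons eq_sym (negPf u00) /=.
  by apply/negP => /tr/rts_neq0; rewrite eqxx.
- move=> z; rewrite /G mem_rcons in_cons; case: eqP => [-> //|zu /= /tr zr].
  by have := fib_rts zr; rewrite /F; case: eqP.
- move=> z z0 zt; rewrite disc0 (negPf z0) /= negb_or.
  rewrite (contra (@rt z)) //=; apply: contra zt => /eqP->.
  by rewrite mem_rcons mem_head.
Qed.

Let generic_fibres : u0 \notin rts -> singular_fibres J8 J8_fibres.
Proof.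
move=> ur; apply: (fibres_of (t := rts) (k := KI 1)) => //.
- by rewrite rcons_uniq ur uniq_rts.
- by move=> z zr; rewrite mem_rcons in_cons zr orbT.
- exact: fib_u0.
Qed.

(** The three conditions keep [u0] away from 1/p, 1/q and 1, in this order: s - 2 p = a + b, 2 q - s
    = a + b - 2 and s - 2 = 2 a b - a - b. *)
Lemma J8_singular_fibres : a + b != 0 -> a + b != 2%:R ->
  2%:R * a * b != a + b -> singular_fibres J8 J8_fibres.
Proof.
move=> ab0 ab2 abab; apply: generic_fibres; apply/negP => ur.
have := Aroot ur; rewrite eqxx => /eqP; rewrite /J8_A !polyE => /eqP.
rewrite mulf_eq0 (negPf u00) /= -/p -/q -/s subr_eq0 => /eqP E.
move: ur; rewrite !inE => /or3P[] /eqP u0E; move: E; rewrite u0E.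
- rewrite mulr1 => E; move/eqP: abab; apply; apply/eqP; rewrite -subr_eq0.
  by rewrite (_ : _ - _ = s - 2%:R); [rewrite -E subrr | rewrite /s /p /q;
    ring].
- move=> /(congr1 ( *%R^~ p)); rewrite divfK // => E; move/eqP: ab0; apply.
  by rewrite (_ : _ + _ = s - 2%:R * p); [rewrite -E subrr | rewrite /s /p /q;
    ring].
- move=> /(congr1 ( *%R^~ q)); rewrite divfK // => E; move/eqP: ab2; apply.
  apply/eqP; rewrite -subr_eq0.
  by rewrite (_ : _ - _ = 2%:R * q - s); [rewrite -E subrr | rewrite /s /p /q;
    ring].
Qed.

Lemma J8_singular_fibres_collision :
  exists2 l, collision J8_fibres l & singular_fibres J8 l.
Proof.
have [ur|/generic_fibres ?] := boolP (u0 \in rts); last first.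
  by exists J8_fibres => //; apply: collision_none.
exists [:: KIIIs; KIs 2; KI 2; KI 2; KIII].
  by apply: (@collision_III [:: KIIIs; KIs 2; KI 2; KI 2] [::]);
    apply: collision_none.
have sr : size (rem u0 rts) = 2%N by rewrite size_rem.
have := @fibres_of (rem u0 rts) KIII; rewrite sr; apply.
- by rewrite rcons_uniq rem_uniq // mem_rem_uniq // !inE eqxx.
- exact: mem_rem.
- by move=> z; rewrite (perm_mem (perm_to_rem ur)) mem_rcons.
- by have := fib_rts ur; rewrite /F eqxx.
Qed.
End J8.

(** * The transformations *)

Section DivringClosed.
Variables (F : fieldType) (S : {pred F}).
Hypothesis closedS : GRing.divring_closed S.
HB.instance Definition _ := GRing.isDivringClosed.Build F S closedS.

(** [rational_in] and [generated_by] quantify over bare predicates; these restatements carry the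
    closure proof as an argument for use outside the section. *)
Lemma divring1 : 1 \in S. Proof. exact: rpred1. Qed.
Lemma divringD x y : x \in S -> y \in S -> x + y \in S.
Proof. exact: rpredD. Qed.
Lemma divringN x : x \in S -> - x \in S.
Proof. by rewrite rpredN. Qed.
Lemma divringM x y : x \in S -> y \in S -> x * y \in S.
Proof. exact: rpredM. Qed.
Lemma divringX n x : x \in S -> x ^+ n \in S.
Proof. exact: rpredX. Qed.
Lemma divringV x : x \in S -> x^-1 \in S.
Proof. by rewrite rpredV. Qed.

Lemma coef_wcubic_divring A B G i j : A \is a polyOver S ->
  B \is a polyOver S -> G \is a polyOver S -> (wcubic A B G)`_i`_j \in S.
Proof.
move=> /polyOverP SA /polyOverP SB /polyOverP SG; rewrite coef_wcubic.
by case: i => [|[|[|[|i]]]] //=; rewrite ?nth_nil ?coef0 ?coef1 ?rpred0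
  ?rpred_nat.
Qed.

Variables a b : F.
Hypotheses (Sa : a \in S) (Sb : b \in S).

Let Sp : (a - 1) * (b - 1) \in S.
Proof. by rewrite rpredM ?rpredB ?rpred1. Qed.
Let Sq : a * b \in S. Proof. by rewrite rpredM. Qed.

Lemma J8_A_divring : J8_A a b \is a polyOver S.
Proof.
rewrite /J8_A rpredM ?polyOverX // rpredB ?rpred_nat //.
by rewrite rpredM ?polyOverX // polyOverC !rpredD ?rpred1.
Qed.
Lemma J8_B_divring : J8_B a b \is a polyOver S.
Proof.
rewrite /J8_B rpredM ?rpredX ?polyOverX //.
by rewrite !rpredM ?rpredB ?rpred1 ?polyOverX ?rpredM ?polyOverX ?polyOverC.
Qed.
Lemma J11_A_divring : J11_A a b \is a polyOver S.
Proof.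
rewrite /J11_A rpredM ?polyOverX // rpredD // ?rpredB ?rpredM //.
all: by rewrite ?rpredX ?polyOverX ?polyOverC ?rpredD ?rpred1.
Qed.
Lemma J11_B_divring : J11_B a b \is a polyOver S.
Proof.
rewrite /J11_B !rpredM ?rpredB ?rpredM ?rpredX ?polyOverX ?polyOverC //.
all: by rewrite ?rpredD ?rpredM ?rpred1 ?rpred_nat.
Qed.
Lemma J11_G_divring : J11_G a b \is a polyOver S.
Proof.
by rewrite /J11_G rpredM ?rpredX ?polyOverX ?polyOverC // rpredM ?rpredX.
Qed.
Variables e f c m : F.
Hypotheses (Se : e \in S) (Sf : f \in S) (Sc : c \in S) (Sm : m \in S).
Let SV : 'X - m%:P \is a polyOver S.
Proof. by rewrite polyOverXsubC. Qed.
Lemma J10_A_divring : J10_A e f m \is a polyOver S.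
Proof. by rewrite /J10_A !rpredM // rpredB ?polyOverC. Qed.
Lemma J10_B_divring : J10_B e f c m \is a polyOver S.
Proof.
rewrite /J10_B !rpredM ?rpredX ?polyOverC // rpredB ?rpredM ?rpred_nat //.
by rewrite polyOverC rpredD.
Qed.
Lemma J10_G_divring : J10_G c m \is a polyOver S.
Proof. by rewrite /J10_G rpredM ?rpredX ?polyOverC. Qed.
End DivringClosed.

Ltac divring_mem dS := repeat first
  [ assumption | exact: (divring1 dS) | apply: (divringD dS) | apply:
    (divringN dS)
  | apply: (divringM dS) | apply: (divringX _ dS) | apply: (divringV dS) ].

Section Derivation.
Variables (C K : fieldType) (iota : {rmorphism C -> K}) (D : K -> K).
Hypothesis derD : derivation iota D.

Lemma derivation_add x y : D (x + y) = D x + D y. Proof. by case: derD. Qed.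
Lemma derivation_mul x y : D (x * y) = D x * y + x * D y.
Proof. by case: derD. Qed.
Lemma derivation_const c : D (iota c) = 0. Proof. by case: derD. Qed.
Lemma derivation1 : D 1 = 0.
Proof. by rewrite -(rmorph1 iota) derivation_const. Qed.
Lemma derivation_opp x : D (- x) = - D x.
Proof.
by rewrite -mulN1r derivation_mul -(rmorph1 iota) -rmorphN derivation_const;
  rewrite mul0r add0r rmorphN rmorph1 mulN1r.
Qed.
Lemma derivation_exp x n : D (x ^+ n.+1) = n.+1%:R * x ^+ n * D x.
Proof.
elim: n => [|n IH]; first by rewrite expr1 expr0; ring.
by rewrite exprS derivation_mul IH -[n.+2]addn1 natrD !exprS; ring.
Qed.
Lemma derivation_div x y : y != 0 -> D (x / y) = (D x * y - x * D y) / y ^+ 2.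
Proof.
move=> y0; apply: (mulIf y0).
(* The quotient rule is the product rule for (x / y) y = x. *)
have {1}-> : D (x / y) * y = D (x / y * y) - x / y * D y.
  by rewrite [D (x / y * y)]derivation_mul; ring.
by rewrite divfK //; field.
Qed.
Definition derivationE := (derivation_add, derivation_opp, derivation_mul,
  derivation_exp, derivation_const, derivation1).
End Derivation.

Section Transfer.
Variables (C K : fieldType) (iota : {rmorphism C -> K}).

Lemma generated_by_sub (g g' : seq K) : generated_by iota g ->
  (forall S : {pred K}, GRing.divring_closed S -> (forall c, iota c \in S) ->
     {subset g' <= S} -> {subset g <= S}) ->
  generated_by iota g'.
Proof. by move=> gg gS S dS cS gS'; apply: gg => //; apply: gS. Qed.

Lemma weierstrass_y_neq0 f u x y : weierstrass_coordinates iota f u x y -> y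
  != 0.
Proof.
case=> fm _ ux _ yE; rewrite -(sqrf_eq0 y) yE.
by apply: ux; apply: monic_neq0.
Qed.

Lemma ev2_wcubic A B G u x : ev2 iota (wcubic A B G) u x
  = x ^+ 3 + ev1 iota A u * x ^+ 2 + ev1 iota B u * x + ev1 iota G u.
Proof. by rewrite /wcubic !ev2E. Qed.
End Transfer.

(** * From J_7 to J_8 and J_11 *)

Section FromJ7.
Variables (C : numFieldType) (K : fieldType) (iota : {rmorphism C -> K}).
Variables (l1 l2 : C) (u x y : K).
Hypotheses (l11 : l1 != 1) (l20 : l2 != 0) (l21 : l2 != 1).
Hypothesis wc : weierstrass_coordinates iota (J7 l1 l2) u x y.
Let a := iota l1.
Let b := iota l2.

Let nK n : n.+1%:R != 0 :> K.
Proof. by rewrite -(rmorph_nat iota) fmorph_eq0 natr_neq0. Qed.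

Let ux : alg_indep iota u x. Proof. by case: wc. Qed.
Let u0 : u != 0.
Proof.
by have := @alg_indep_ev1_neq0 _ _ _ _ _ 'X ux; rewrite polyX_eq0 ev1X; apply.
Qed.
Let w0 : u - 1 != 0.
Proof.
have := @alg_indep_ev1_neq0 _ _ _ _ _ ('X - 1%:P) ux.
by rewrite polyXsubC_eq0 polyC1 !ev1E; apply.
Qed.
Let x0 : x != 0.
Proof. by have := alg_indep_sub_neq0 0 ux; rewrite ev1_0 subr0. Qed.
Let y0 : y != 0. Proof. exact: weierstrass_y_neq0 wc. Qed.

Let yE : y ^+ 2 = x * (x ^+ 2
  - u * (u - 1) * ((a * b + 1) * u - (a + b)) * x + a * b * u ^+ 2 * (u
    - 1) ^+ 4).
Proof.
case: wc => _ _ _ _ ->.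
rewrite /J7 /normal_form /J7_G2 /J7_G3 /J7_shift /N7 !ev2E !ev1E.
by field; rewrite (nK 26) (nK 3) (nK 2).
Qed.
Lemma alg_indep_quot h : h != 0 -> alg_indep iota u (ev1 iota h u / x).
Proof. by move=> h0; apply/alg_indep_scale/alg_indep_inv. Qed.

Let p := (a - 1) * (b - 1).
Let pE : iota ((l1 - 1) * (l2 - 1)) = p.
Proof. by rewrite rmorphM !rmorphB !rmorph1. Qed.
Let p0 : p != 0.
Proof. by rewrite -pE fmorph_eq0 mulf_neq0 ?subr_eq0. Qed.
Let b0 : b != 0. Proof. by rewrite fmorph_eq0. Qed.
Let z := x - p * u ^+ 2 * (u - 1).
Let z0 : z != 0.
Proof.
have := alg_indep_sub_neq0 (((l1 - 1) * (l2 - 1)) *: ('X ^+ 2 * ('X - 1))) ux.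
by rewrite !ev1E pE; congr (_ != 0); rewrite /z; ring.
Qed.

Let w_neq0 : 'X - 1 != 0 :> {poly C}.
Proof. by rewrite -polyC1 polyXsubC_eq0. Qed.

Let u8 := u ^+ 2 * (u - 1) / x.
Let x8 := z * u ^+ 2 / x ^+ 2.
Let y8 := - (z * u ^+ 4 * y / x ^+ 4).


Lemma J8_weierstrass : weierstrass_coordinates iota
  (wcubic (J8_A l1 l2) (J8_B l1 l2) 0) u8 x8 y8.
Proof.
split; [exact: wcubic_monic | exact: size_wcubic | | | ].
- have h0 : 'X ^+ 2 * ('X - 1) != 0 :> {poly C}.
    by rewrite mulf_neq0 ?expf_neq0 ?polyX_eq0.
  have := alg_indep_quot h0.
  (* Since x8 = u8 (1 - p u8) / (u - 1), taking [u8] as the base leads from u to [x8] by a shift, an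
     inversion and a scaling. The same identity recovers u from [u8] and [x8] below. *)
  rewrite !ev1E -/u8 => /alg_indep_swap/(alg_indep_shift (- 1)).
  rewrite !ev1E => /alg_indep_inv/(@alg_indep_scale _ _ _ _ _
    ('X * (1 - ((l1 - 1) * (l2 - 1))%:P * 'X))).
  rewrite !ev1E pE (_ : _ * (u - 1)^-1 = x8); last first.
    by rewrite /u8 /x8 /z; field; rewrite x0 w0.
  apply; rewrite mulf_neq0 ?polyX_eq0 //; apply/eqP => /polyP/(_ 0%N)/eqP.
  by rewrite coefB coef1 mulrC coefXM subr0 coef0 oner_eq0.
- case: wc => _ _ _ gen _; apply: generated_by_sub gen _ => S dS cS gS.
  have Su8 : u8 \in S by apply: gS; rewrite !inE eqxx.
  have Sx8 : x8 \in S by apply: gS; rewrite !inE eqxx orbT.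
  have Sy8 : y8 \in S by apply: gS; rewrite !inE eqxx !orbT.
  have Sp : p \in S by rewrite -pE.
  have Su : u \in S.
    have -> : u = 1 + u8 * (1 - p * u8) / x8.
      have -> : 1 - p * u8 = z / x by rewrite /u8 /z; field.
      by rewrite /u8 /x8; field; rewrite x0 u0 z0.
    by divring_mem dS.
  have Sx : x \in S.
    have -> : x = u ^+ 2 * (u - 1) / u8 by rewrite /u8; field; rewrite x0 u0 w0.
    by divring_mem dS.
  have Sy : y \in S.
    have -> : y = - y8 * x ^+ 4 / (z * u ^+ 4).
      by rewrite /y8; field; rewrite x0 u0 z0.
    have Sz : z \in S by rewrite /z; divring_mem dS.
    by divring_mem dS.
  by move=> v; rewrite !inE => /or3P[] /eqP->.
- rewrite ev2_wcubic /J8_A /J8_B !ev1E pE.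
  rewrite (_ : y8 ^+ 2 = z ^+ 2 * u ^+ 8 * y ^+ 2 / x ^+ 8); last first.
    by rewrite /y8; field.
  rewrite yE rmorphM -/a -/b /x8 /u8 /z /p; field; exact: x0.
Qed.

Lemma J8_two_form D1 D2 : derivation iota D1 -> derivation iota D2 ->
  two_form u8 x8 y8 D1 D2 = two_form u x y D1 D2.
Proof.
move=> d1 d2; rewrite /two_form /u8 /x8 /y8 /z.
rewrite !(derivation_div d1) ?expf_neq0 // !(derivation_div d2) ?expf_neq0 //.
rewrite -pE -(rmorph1 iota) !(derivationE d1) !(derivationE d2) pE rmorph1.
field; rewrite y0 x0 oppr_eq0 -/z.
exact: mulf_neq0 (mulf_neq0 z0 (expf_neq0 4 u0)) y0.
Qed.


Let u11 := b * u ^+ 2 * (u - 1) ^+ 2 / x.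
Let x11 :=
  - (b ^+ 2 * (a - 1) * (b - 1) * u ^+ 4 * (u - 1) ^+ 3 / x ^+ 2).
Let y11 :=
  b ^+ 3 * (a - 1) * (b - 1) * u ^+ 6 * (u - 1) ^+ 4 * y / x ^+ 4.

(** Over C(u11) this is a Moebius function of u alone, which gives both the independence of [u11]
    and [x11] and the recovery of u. *)
Let x11E : x11 = - (p * u11 ^+ 2 / (u - 1)).
Proof. by rewrite /x11 /u11 /p; field; rewrite x0 w0. Qed.
Let y11E : y11 = p * u11 ^+ 4 / (b * u ^+ 2 * (u - 1) ^+ 4) * y.
Proof. by rewrite /y11 /u11 /p; field; rewrite x0 w0 b0 u0. Qed.

Let u110 : u11 != 0.
Proof. by rewrite /u11 !mulf_neq0 ?expf_neq0 ?invr_eq0. Qed.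
Let x110 : x11 != 0.
Proof.
rewrite x11E oppr_eq0.
exact: mulf_neq0 (mulf_neq0 p0 (expf_neq0 2 u110)) (invr_neq0 w0).
Qed.

Lemma J11_weierstrass : weierstrass_coordinates iota
  (wcubic (J11_A l1 l2) (J11_B l1 l2) (J11_G l1 l2)) u11 x11 y11.
Proof.
split; [exact: wcubic_monic | exact: size_wcubic | | | ].
- have h0 : l2%:P * 'X ^+ 2 * ('X - 1) ^+ 2 != 0.
    by rewrite !mulf_neq0 ?expf_neq0 ?polyX_eq0 ?polyC_eq0.
  have := alg_indep_quot h0.
  rewrite !ev1E -/b -/u11 => /alg_indep_swap/(alg_indep_shift (- 1)).
  rewrite !ev1E => /alg_indep_inv/(@alg_indep_scale _ _ _ _ _
    (- (((l1 - 1) * (l2 - 1))%:P * 'X ^+ 2))).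
  rewrite !ev1E pE mulNr -x11E; apply.
  by rewrite oppr_eq0 mulf_neq0 ?expf_neq0 ?polyX_eq0 // polyC_eq0 mulf_neq0
    ?subr_eq0.
- case: wc => _ _ _ gen _; apply: generated_by_sub gen _ => S dS cS gS.
  have Su11 : u11 \in S by apply: gS; rewrite !inE eqxx.
  have Sx11 : x11 \in S by apply: gS; rewrite !inE eqxx orbT.
  have Sy11 : y11 \in S by apply: gS; rewrite !inE eqxx !orbT.
  have Sp : p \in S by rewrite -pE.
  have Sb : b \in S by apply: cS.
  have Su : u \in S.
    have -> : u = 1 - p * u11 ^+ 2 / x11.
      by apply: (mulIf x110); rewrite mulrBl divfK // x11E; field.
    by divring_mem dS.
  have Sx : x \in S.
    have -> : x = b * u ^+ 2 * (u - 1) ^+ 2 / u11.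
      by rewrite /u11; field; rewrite x0 u0 w0 b0.
    by divring_mem dS.
  have Sy : y \in S.
    have -> : y = y11 / (p * u11 ^+ 4 / (b * u ^+ 2 * (u - 1) ^+ 4)).
      by rewrite y11E; field; rewrite u110 u0 w0 b0 p0.
    by divring_mem dS.
  by move=> v; rewrite !inE => /or3P[] /eqP->.
- rewrite ev2_wcubic /J11_A /J11_B /J11_G !ev1E.
  rewrite y11E exprMn yE x11E /u11 /p
    !(rmorphM, rmorphB, rmorphD, rmorphXn, rmorph1, rmorph_nat).
  rewrite -/a -/b; by field; rewrite ?x0 ?w0 ?b0 ?u0.
Qed.

Lemma J11_two_form D1 D2 : derivation iota D1 -> derivation iota D2 ->
  two_form u11 x11 y11 D1 D2 = two_form u x y D1 D2.
Proof.
move=> d1 d2; rewrite /two_form.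
have derx D : derivation iota D ->
    D x11 = - ((p * (2%:R * u11 * D u11) * (u - 1) - p * u11 ^+ 2 * D u) /
      (u - 1) ^+ 2).
  move=> d; rewrite x11E (derivation_opp d) (derivation_div d) //.
  by rewrite -pE -(rmorph1 iota) !(derivationE d); congr (- (_ / _)); ring.
have deru D : derivation iota D ->
    D u11 = b * (2%:R * u * (u - 1) ^+ 2 * D u + u ^+ 2 * 2%:R * (u
      - 1) * D u) / x
      - b * u ^+ 2 * (u - 1) ^+ 2 * D x / x ^+ 2.
  move=> d; rewrite /u11 (derivation_div d) //.
  by rewrite -(rmorph1 iota) !(derivationE d); field.
rewrite (derx _ d1) (derx _ d2) (deru _ d1) (deru _ d2) y11E /u11.
by field; rewrite ?x0 ?w0 ?b0 ?u0 ?y0 ?p0.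
Qed.
End FromJ7.

(** * From J_9 to J_10 *)

Section FromJ9.
Variables (C : numFieldType) (K : fieldType) (iota : {rmorphism C -> K}).
Variables (l1 l2 e f m : C) (u x y : K).
Hypotheses (l10 : l1 != 0) (l11 : l1 != 1) (l20 : l2 != 0) (l21 : l2 != 1).
Let c := l1 * l2 * (l1 - 1) * (l2 - 1).
Let a := iota l1.
Let b := iota l2.
Hypotheses (sqr_d9E : sqr_d9 l1 l2 = (e + f) ^+ 2 - 3%:R * e * f)
  (numB9E : numB9 l1 l2 = (e + f) ^+ 3 - 3%:R * sqr_d9 l1 l2 * (e + f))
  (numA9E : numA9 l1 l2 = numB9 l1 l2 + 27%:R * c).
Hypothesis wc : weierstrass_coordinates iota
  (J9 l1 l2 ((((e + f) / 3%:R) *: 'X + m%:P) * ('X - 1) ^+ 2)) u x y.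

Let nK n : n.+1%:R != 0 :> K.
Proof. by rewrite -(rmorph_nat iota) fmorph_eq0 natr_neq0. Qed.

Let ux : alg_indep iota u x. Proof. by case: wc. Qed.
Let w0 : u - 1 != 0.
Proof.
have := @alg_indep_ev1_neq0 _ _ _ _ _ ('X - 1%:P) ux.
by rewrite polyXsubC_eq0 polyC1 !ev1E; apply.
Qed.
Let y0 : y != 0. Proof. exact: weierstrass_y_neq0 wc. Qed.
Let c0 : c != 0. Proof. by rewrite /c !mulf_neq0 ?subr_eq0. Qed.

Let g := iota c.
Let gE : g = a * b * (a - 1) * (b - 1).
Proof. by rewrite /g /c !rmorphM !rmorphB !rmorph1. Qed.
Let g0 : g != 0. Proof. by rewrite fmorph_eq0. Qed.

Let u10 := x / (u - 1) ^+ 2.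
Let x10 := - (a * b * (a - 1) * (b - 1) * u / (u - 1)).
Let y10 := - (a * b * (a - 1) * (b - 1) * y / (u - 1) ^+ 4).

Let x10E : x10 = - (g * u / (u - 1)). Proof. by rewrite gE. Qed.
Let y10E : y10 = - (g * y / (u - 1) ^+ 4). Proof. by rewrite gE. Qed.

Let yE : y ^+ 2 =
  let X := x - ((iota e + iota f) / 3%:R * u + iota m) * (u - 1) ^+ 2 in
  X ^+ 3 - 3%:R^-1 * iota (sqr_d9 l1 l2) * (u ^+ 2 * (u - 1) ^+ 4) * X
  + 27%:R^-1 * (u ^+ 3 * (u - 1) ^+ 5
                * (iota (numB9 l1 l2) * u - iota (numA9 l1 l2))).
Proof.
case: wc => _ _ _ _ ->.
rewrite /J9 /normal_form /J9_G2 /J9_G3 !ev2E !ev1E.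
by field; rewrite (nK 26) (nK 3) (nK 2).
Qed.

Lemma J10_weierstrass : weierstrass_coordinates iota
  (wcubic (J10_A e f m) (J10_B e f c m) (J10_G c m)) u10 x10 y10.
Proof.
split; [exact: wcubic_monic | exact: size_wcubic | | | ].
- have h0 : ('X - 1) ^+ 2 != 0 :> {poly C}.
    by rewrite expf_neq0 // -polyC1 polyXsubC_eq0.
  (* Scaling is available for polynomial factors in u only, so the division by (u - 1)^2 takes place
     between two inversions. *)
  have := alg_indep_inv (alg_indep_scale h0 (alg_indep_inv ux)).
  rewrite !ev1E invfM invrK mulrC -/u10.
  move=> /alg_indep_swap/(alg_indep_shift (- 1)).
  have c0P : (- c)%:P != 0 :> {poly C} by rewrite polyC_eq0 oppr_eq0.
  rewrite !ev1E => /alg_indep_inv/(alg_indep_scale c0P).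
  move=> /(alg_indep_shift (- c)%:P); rewrite !ev1E rmorphN -/g.
  by rewrite (_ : _ + _ = x10) // x10E; field.
- case: wc => _ _ _ gen _; apply: generated_by_sub gen _ => S dS cS gS.
  have Su10 : u10 \in S by apply: gS; rewrite !inE eqxx.
  have Sx10 : x10 \in S by apply: gS; rewrite !inE eqxx orbT.
  have Sy10 : y10 \in S by apply: gS; rewrite !inE eqxx !orbT.
  have Sg : g \in S by apply: cS.
  have Su : u \in S.
    (* Splitting u / (u - 1) = 1 + 1 / (u - 1) shows that x10 + g is nonzero, and u is then x10 /
       (x10 + g). *)
    have E : x10 + g = - (g / (u - 1)) by rewrite x10E; field.
    have nz : x10 + g != 0 by rewrite E oppr_eq0 mulf_neq0 ?invr_eq0.
    have -> : u = x10 / (x10 + g).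
      by apply: (mulIf nz); rewrite divfK // mulrDr x10E; field.
    by divring_mem dS.
  have Sx : x \in S.
    have -> : x = u10 * (u - 1) ^+ 2 by rewrite /u10; field.
    by divring_mem dS.
  have Sy : y \in S.
    have -> : y = - y10 * (u - 1) ^+ 4 / g by rewrite y10E; field;
      rewrite w0 g0.
    by divring_mem dS.
  by move=> v; rewrite !inE => /or3P[] /eqP->.
- rewrite ev2_wcubic /J10_A /J10_B /J10_G !ev1E.
  rewrite (_ : y10 ^+ 2 = g ^+ 2 * y ^+ 2 / (u - 1) ^+ 8); last first.
    by rewrite y10E; field.
  rewrite yE; cbv zeta; rewrite numA9E numB9E sqr_d9E x10E /u10.
  rewrite !(rmorph_nat, rmorphXn, rmorphM, rmorphB, rmorphD, rmorph1) gE -/a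
    -/b.
  by field; rewrite ?w0 ?(nK 26) ?(nK 2).
Qed.

Lemma J10_two_form D1 D2 : derivation iota D1 -> derivation iota D2 ->
  two_form u10 x10 y10 D1 D2 = two_form u x y D1 D2.
Proof.
move=> d1 d2; rewrite /two_form.
have derx D : derivation iota D -> D x10 = g * D u / (u - 1) ^+ 2.
  move=> d; rewrite x10E (derivation_opp d) (derivation_div d) //.
  by rewrite -(rmorph1 iota) !(derivationE d); field; rewrite ?rmorph1 ?w0.
have deru D : derivation iota D ->
    D u10 = (D x * (u - 1) - x * 2%:R * D u) / (u - 1) ^+ 3.
  move=> d; rewrite /u10 (derivation_div d) ?expf_neq0 //.
  by rewrite -(rmorph1 iota) !(derivationE d); field; rewrite ?rmorph1 ?w0.
rewrite (derx _ d1) (derx _ d2) (deru _ d1) (deru _ d2) y10E.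
by field; rewrite w0 y0 oppr_eq0 mulf_neq0.
Qed.
End FromJ9.

(** * The theorem *)

(* The first three factors vanish when the I_1 of J_8 meets an I_2; the next
   three, when two I_1 of J_10 meet, one for each of the three values of r in
   J9_shift; the last one, when two I_1 of J_11 meet. *)
Definition degeneracy (R : comNzRingType) (a b : R) : R :=
  (a + b) * (a + b - 2%:R) * (2%:R * a * b - a - b)
  * ((a * b - 1) ^+ 6 + 27%:R * (a * b * (a - 1) * (b - 1)) ^+ 2)
  * ((a * b - a - b) ^+ 6 + 27%:R * (a * b * (a - 1) * (b - 1)) ^+ 2)
  * ((a + b - 1) ^+ 6 + 27%:R * (a * b * (a - 1) * (b - 1)) ^+ 2)
  * (((a - 1) * (b - 1) * (a * b + 1) - (a * b - 1) ^+ 2) ^+ 3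
     - 27%:R * ((a - 1) * (b - 1)) ^+ 2 * (a * b) ^+ 2).

Lemma horner2_degeneracy (R : comNzRingType) (l1 l2 : R) :
  (degeneracy 'X 'Y).[l1%:P].[l2] = degeneracy l1 l2.
Proof. by rewrite /degeneracy !polyE. Qed.

Lemma degeneracy_neq0 (C : numFieldType) :
  degeneracy 'X 'Y != 0 :> {poly {poly C}}.
Proof.
(* A point with a b = 0, where every term with factor 27 vanishes. It is no admissible pair of
   parameters, but one nonzero value suffices for the polynomial. *)
have: degeneracy 0 (-1) != 0 :> C.
  rewrite (_ : degeneracy _ _ = 192%:R); last by rewrite /degeneracy; ring.
  exact: natr_neq0.
by apply: contra_neq => D0; rewrite -horner2_degeneracy D0 !horner0.
Qed.

Section Fibrations.
Variables (C : numClosedFieldType) (K : fieldType) (iota : {rmorphism C -> K}).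
Variables l1 l2 : C.
Hypotheses (l10 : l1 != 0) (l11 : l1 != 1) (l20 : l2 != 0) (l21 : l2 != 1).
Hypothesis non_isog : ~ isogenous l1 l2.

Let orbit : ~~ [|| l2 == l1, l1 + l2 == 1, l1 * l2 == 1, l1 * l2 == l1 + l2,
  l2 * (1 - l1) == 1 | l1 * l2 == l1 - 1].
Proof. by apply/negP => /(isogenous_orbit l10 l11). Qed.

Let ab : l1 != l2.
Proof. by move: orbit; rewrite eq_sym !negb_or => /andP[]. Qed.
Let ab1 : l1 * l2 != 1.
Proof. by move: orbit; rewrite !negb_or => /and4P[]. Qed.
Let aDb : l1 + l2 != 1.
Proof. by move: orbit; rewrite !negb_or => /and3P[]. Qed.
Let abDab : l1 * l2 != l1 + l2.
Proof. by move: orbit; rewrite !negb_or => /and4P[_ _ _ /andP[]]. Qed.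
Let ab_b : l1 * l2 - l2 + 1 != 0.
Proof.
move: orbit; rewrite !negb_or => /and4P[_ _ _ /and3P[_ + _]].
apply: contra_neq => E; apply/eqP; rewrite -subr_eq0.
by rewrite (_ : _ - _ = - (l1 * l2 - l2 + 1)); [rewrite E oppr0 | ring].
Qed.
Let ab_a : l1 * l2 - l1 + 1 != 0.
Proof.
move: orbit; rewrite !negb_or => /and4P[_ _ _ /and3P[_ _]].
apply: contra_neq => E; apply/eqP; rewrite -subr_eq0.
by rewrite (_ : _ - _ = l1 * l2 - l1 + 1); [rewrite E | ring].
Qed.

Let generic := degeneracy l1 l2 != 0.

Lemma J8_fibration u x y (a := iota l1) (b := iota l2) :
  weierstrass_coordinates iota (J7 l1 l2) u x y ->
  let z := x - (a - 1) * (b - 1) * u ^+ 2 * (u - 1) in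
  jacobian_fibration iota l1 l2 generic J8_fibres (u ^+ 2 * (u - 1) / x)
    (z * u ^+ 2 / x ^+ 2) (- (z * u ^+ 4 * y / x ^+ 4)).
Proof.
move=> wc z; exists (wcubic (J8_A l1 l2) (J8_B l1 l2) 0).
(* [p1], [pq] and [ab1] keep the roots 1, 1/p, 1/q of [J8_B] distinct; the first two are l1 l2 != l1
   + l2 and l1 + l2 != 1 in disguise. *)
have p1 : (l1 - 1) * (l2 - 1) != 1.
  apply: contra_neq abDab => E; apply/eqP; rewrite -subr_eq0.
  by rewrite (_ : _ - _ = (l1 - 1) * (l2 - 1) - 1); [rewrite E subrr | ring].
have pq : (l1 - 1) * (l2 - 1) != l1 * l2.
  apply: contra_neq aDb => E; apply/eqP; rewrite -subr_eq0.
  by rewrite (_ : _ - _ = l1 * l2 - (l1 - 1) * (l2 - 1));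
    [rewrite E subrr | ring].
split.
- exact: J8_weierstrass wc.
- move=> i j S dS Sl1 Sl2; apply: coef_wcubic_divring => //.
  + exact: J8_A_divring.
  + exact: J8_B_divring.
  + apply/polyOverP => k; rewrite coef0 -(subrr 1).
    by rewrite (divringD dS) ?(divringN dS) ?(divring1 dS).
- rewrite /generic /degeneracy; do 4! [rewrite mulf_eq0 negb_or => /andP[+ _]].
  rewrite !mulf_eq0 !negb_or => /andP[/andP[D1 D2] D3].
  apply: J8_singular_fibres => //; first by rewrite -subr_eq0.
  by rewrite -subr_eq0 opprD addrA.
- exact: J8_singular_fibres_collision.
Qed.

Lemma J11_fibration u x y (a := iota l1) (b := iota l2) :
  weierstrass_coordinates iota (J7 l1 l2) u x y ->
  jacobian_fibration iota l1 l2 generic J11_fibres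
    (b * u ^+ 2 * (u - 1) ^+ 2 / x)
    (- (b ^+ 2 * (a - 1) * (b - 1) * u ^+ 4 * (u - 1) ^+ 3 / x ^+ 2))
    (b ^+ 3 * (a - 1) * (b - 1) * u ^+ 6 * (u - 1) ^+ 4 * y / x ^+ 4).
Proof.
move=> wc; exists (wcubic (J11_A l1 l2) (J11_B l1 l2) (J11_G l1 l2)); split.
- exact: J11_weierstrass wc.
- move=> i j S dS Sl1 Sl2; apply: coef_wcubic_divring => //.
  + exact: J11_A_divring.
  + exact: J11_B_divring.
  + exact: J11_G_divring.
- rewrite /generic /degeneracy mulf_eq0 negb_or => /andP[_ D].
  exact: J11_singular_fibres.
- exact: J11_singular_fibres_collision.
Qed.

Let c := l1 * l2 * (l1 - 1) * (l2 - 1).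

(** The identities for [sqr_d9] and [numB9] match the normal form of J_9 with its factored cubic.
    The last clause evaluates the discriminant of x (x - e) (x - f) + c, on which the I_0^* at u = m
    depends; non-isogeny makes each factor on the right nonzero. *)
Definition J10_parameters (e f : C) : Prop :=
  [/\ rational_in l1 l2 e /\ rational_in l1 l2 f,
      sqr_d9 l1 l2 = (e + f) ^+ 2 - 3%:R * e * f,
      numB9 l1 l2 = (e + f) ^+ 3 - 3%:R * sqr_d9 l1 l2 * (e + f),
      e != f /\ (generic -> (e - f) ^+ 6 + 27%:R * c ^+ 2 != 0)
    & (e - f) ^+ 2 * (e * f) ^+ 2 + 4%:R * c * (e + f) ^+ 3
      - 18%:R * c * (e * f) * (e + f) - 27%:R * c ^+ 2
      = (l1 - l2) ^+ 2 * (l1 * l2 - l2 + 1) ^+ 2 * (l1 * l2 - l1 + 1) ^+ 2].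

Lemma J9_shift_parameters p : J9_shift l1 l2 p -> exists e f m : C,
  [/\ rational_in l1 l2 m, J10_parameters e f
    & p = (((e + f) / 3%:R) *: 'X + m%:P) * ('X - 1) ^+ 2].
Proof.
case=> r [m [rE mS ->]].
suff [e [f [-> ef]]] : exists e f, r = e + f /\ J10_parameters e f.
  by exists e, f, m.
have gen : generic -> [/\ (l1 * l2 - 1) ^+ 6 + 27%:R * c ^+ 2 != 0,
    (l1 * l2 - l1 - l2) ^+ 6 + 27%:R * c ^+ 2 != 0
  & (l1 + l2 - 1) ^+ 6 + 27%:R * c ^+ 2 != 0].
  rewrite /generic /degeneracy mulf_eq0 negb_or => /andP[+ _].
  by rewrite !mulf_eq0 !negb_or => /andP[/andP[/andP[_ ->] ->] ->].
move: rE; rewrite !inE => /or3P[] /eqP->.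
(* Up to sign, [e] and [f] are two of l1 l2 - 1, l1 l2 - l1 - l2 and l1 + l2 - 1, and e - f is the
   third. So each value of [r] meets its own factor of [degeneracy]. *)
- exists (l1 * l2 - 1), (l1 * l2 - l1 - l2); split; first by ring.
  split; first by split=> S dS Sa Sb; divring_mem dS.
  + by rewrite /sqr_d9; ring.
  + by rewrite /numB9 /sqr_d9; ring.
  + split; first by rewrite -subr_eq0; move: aDb; rewrite -subr_eq0;
      congr (_ != 0); ring.
    by case/gen => _ _; congr (_ != 0); ring.
  + by rewrite /c; ring.
- exists (1 - l1 * l2), (1 - l1 - l2); split; first by ring.
  split; first by split=> S dS Sa Sb; divring_mem dS.
  + by rewrite /sqr_d9; ring.
  + by rewrite /numB9 /sqr_d9; ring.
  + split; first by rewrite -subr_eq0; move: abDab; rewrite eq_sym -subr_eq0;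
      congr (_ != 0); ring.
    by case/gen => _ + _; congr (_ != 0); ring.
  + by rewrite /c; ring.
- exists (l1 + l2 - l1 * l2), (l1 + l2 - 1); split; first by ring.
  split; first by split=> S dS Sa Sb; divring_mem dS.
  + by rewrite /sqr_d9; ring.
  + by rewrite /numB9 /sqr_d9; ring.
  + split; first by rewrite -subr_eq0; move: ab1; rewrite eq_sym -subr_eq0;
      congr (_ != 0); ring.
    by case/gen => + _ _; congr (_ != 0); ring.
  + by rewrite /c; ring.
Qed.

Lemma J10_fibration p u x y (a := iota l1) (b := iota l2) :
  J9_shift l1 l2 p -> weierstrass_coordinates iota (J9 l1 l2 p) u x y ->
  let x10 := - (a * b * (a - 1) * (b - 1) * u / (u - 1)) in
  let y10 := - (a * b * (a - 1) * (b - 1) * y / (u - 1) ^+ 4) in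
  jacobian_fibration iota l1 l2 generic J10_fibres (x / (u - 1) ^+ 2) x10 y10 /\
  (forall D1 D2, derivation iota D1 -> derivation iota D2 ->
     two_form (x / (u - 1) ^+ 2) x10 y10 D1 D2 = two_form u x y D1 D2).
Proof.
move=> /J9_shift_parameters[e [f [m [Sm [[Se Sf] H1 H2 [ef gen] Q] ->]]]] wc.
have H3 : numA9 l1 l2 = numB9 l1 l2 + 27%:R * c.
  by rewrite /numA9 /numB9 /c; ring.
have c0 : c != 0 by rewrite /c !mulf_neq0 ?subr_eq0.
have Q0 : (e - f) ^+ 2 * (e * f) ^+ 2 + 4%:R * c * (e + f) ^+ 3
      - 18%:R * c * (e * f) * (e + f) - 27%:R * c ^+ 2 != 0.
  by rewrite Q !mulf_neq0 ?expf_neq0 ?subr_eq0.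
move=> x10 y10; split; last first.
  move=> D1 D2 d1 d2; exact (J10_two_form l10 l11 l20 l21 wc d1 d2).
exists (wcubic (J10_A e f m) (J10_B e f c m) (J10_G c m)); split.
- exact: J10_weierstrass wc.
- move=> i j S dS Sl1 Sl2; have Sc : c \in S by rewrite /c; divring_mem dS.
  have {}Se := Se S dS Sl1 Sl2; have {}Sf := Sf S dS Sl1 Sl2.
  have {}Sm := Sm S dS Sl1 Sl2; apply: coef_wcubic_divring => //.
  + exact: J10_A_divring.
  + exact: J10_B_divring.
  + exact: J10_G_divring.
- by move=> /gen; apply: J10_singular_fibres.
- exact: J10_singular_fibres_collision.
Qed.

End Fibrations.

Theorem proposition2p7 (R : realType) :
  exists2 D : {poly {poly R[i]}}, D != 0 &
  forall l1 l2 : R[i],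
  l1 != 0 -> l1 != 1 -> l2 != 0 -> l2 != 1 -> ~ isogenous l1 l2 ->
  forall (K : fieldType) (iota : {rmorphism R[i] -> K}),
  kummer_function_field iota l1 l2 ->
  let generic := D.[l1%:P].[l2] != 0 in
  let a := iota l1 in
  let b := iota l2 in
  [/\ forall u7 x7 y7 : K,
        weierstrass_coordinates iota (J7 l1 l2) u7 x7 y7 ->
        let z := x7 - (a - 1) * (b - 1) * u7 ^+ 2 * (u7 - 1) in
        let u8 := u7 ^+ 2 * (u7 - 1) / x7 in
        let x8 := z * u7 ^+ 2 / x7 ^+ 2 in
        let y8 := - (z * u7 ^+ 4 * y7 / x7 ^+ 4) in
        jacobian_fibration iota l1 l2 generic J8_fibres u8 x8 y8 /\
        (forall D1 D2, derivation iota D1 -> derivation iota D2 ->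
           two_form u8 x8 y8 D1 D2 = two_form u7 x7 y7 D1 D2),
      forall p9 : {poly R[i]}, J9_shift l1 l2 p9 ->
      forall u9 x9 y9 : K,
        weierstrass_coordinates iota (J9 l1 l2 p9) u9 x9 y9 ->
        let u10 := x9 / (u9 - 1) ^+ 2 in
        let x10 := - (a * b * (a - 1) * (b - 1) * u9 / (u9 - 1)) in
        let y10 := - (a * b * (a - 1) * (b - 1) * y9 / (u9 - 1) ^+ 4) in
        jacobian_fibration iota l1 l2 generic J10_fibres u10 x10 y10 /\
        (forall D1 D2, derivation iota D1 -> derivation iota D2 ->
           two_form u10 x10 y10 D1 D2 = two_form u9 x9 y9 D1 D2)
    & forall u7 x7 y7 : K,
        weierstrass_coordinates iota (J7 l1 l2) u7 x7 y7 ->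
        let u11 := b * u7 ^+ 2 * (u7 - 1) ^+ 2 / x7 in
        let x11 :=
          - (b ^+ 2 * (a - 1) * (b - 1) * u7 ^+ 4 * (u7 - 1) ^+ 3 / x7 ^+ 2) in
        let y11 :=
          b ^+ 3 * (a - 1) * (b - 1) * u7 ^+ 6 * (u7 - 1) ^+ 4 * y7
          / x7 ^+ 4 in
        jacobian_fibration iota l1 l2 generic J11_fibres u11 x11 y11 /\
        (forall D1 D2, derivation iota D1 -> derivation iota D2 ->
           two_form u11 x11 y11 D1 D2 = two_form u7 x7 y7 D1 D2)].
Proof.
exists (degeneracy 'X 'Y); first exact: degeneracy_neq0.
move=> l1 l2 l10 l11 l20 l21 non_isog K iota _; rewrite horner2_degeneracy.
move=> generic a b; split=>
  [u x y wc z u8 x8 y8|p sp u x y wc|u x y wc u11 x11 y11].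
- by split; [exact: J8_fibration | exact: J8_two_form].
- exact: J10_fibration sp wc.
- by split; [exact: J11_fibration | exact: J11_two_form].
Qed.
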